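(* Let $G$ be an infinite locally soluble group with $G \neq G'$, and let $A$ be a $\mathbb{Z}G$-module with $C_G(A)=1$, where $\mathbb{Z}$ is the ring of integers. Suppose that $A/C_A(G)$ is not a minimax $\mathbb{Z}$-module and that $A/C_A(H)$ is a minimax $\mathbb{Z}$-module for every proper subgroup $H$ of $G$. Then $G$ is isomorphic to a quasi-cyclic $q$-group $C_{q^{\infty}}$ for some prime $q$.
   Context: $G'$ denotes the derived (commutator) subgroup of $G$. A group is locally soluble if each of its finitely generated subgroups is soluble. For a module $A$ over the group ring $\mathbf{R}G$ and a subgroup $H \le G$, $C_A(H)=\{a\in A : ah=a \text{ for all } h\in H\}$, which is an $\mathbf{R}$-submodule of $A$, and $C_G(A)=\{g\in G : ag=a \text{ for all } a\in A\}$. An $\mathbf{R}$-module is minimax if it has a finite series of submodules each of whose factors is either a noetherian $\mathbf{R}$-module or an artinian $\mathbf{R}$-module. The quasi-cyclic $q$-group $C_{q^{\infty}}$ is the Prüfer $q$-group, i.e. the $q$-primary component of $\mathbb{Q}/\mathbb{Z}$. *)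

(* Defs.v *)
From HB Require Import structures.
From mathcomp Require Import all_boot all_order all_algebra.
From mathcomp Require Import all_classical.

Set Implicit Arguments.
Unset Strict Implicit.
Unset Printing Implicit Defensive.

Import GRing.Theory.
Local Open Scope classical_set_scope.
Local Open Scope ring_scope.

Section Groups.
Variable G : groupType.
Implicit Types (H S : set G).

Definition subgroup H : Prop := group_closed (mem H).

Definition generated S : set G := smallest subgroup S.

Definition derived H : set G :=
  generated [set [~ x, y]%g | x in H & y in H].

Definition soluble H : Prop := exists n, iter n derived H = [set 1%g].

Definition locally_soluble : Prop :=
  forall s : seq G, soluble (generated [set` s]).

End Groups.

(* Z-modules are abelian groups: a Z-module is a [zmodType], and its
   submodules are the [zmodClosed] predicates on it.  These predicates are
   boolean, which is no restriction because [asbool] reflects every Prop. *)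

Definition quotmod (V : zmodType) (L : zmodClosed V) : zmodType :=
  Quotient.quot L.

Definition submod (V : zmodType) (M : zmodClosed V) := {x : V | x \in M}.

HB.instance Definition _ (V : zmodType) (M : zmodClosed V) :=
  SubChoice.on (submod M).
HB.instance Definition _ (V : zmodType) (M : zmodClosed V) :=
  [SubChoice_isSubZmodule of submod M by <:].

Definition restr_pred (V : zmodType) (M L : zmodClosed V) : {pred submod M} :=
  [pred x | val x \in L].
Arguments restr_pred {V} M L.

Lemma restr_pred_zmod_closed (V : zmodType) (M L : zmodClosed V) :
  zmod_closed (restr_pred M L).
Proof.
by split=> [|x y]; rewrite !inE ?raddf0 ?rpred0 // raddfB; apply: rpredB.
Qed.

HB.instance Definition _ (V : zmodType) (M L : zmodClosed V) :=
  GRing.isZmodClosed.Build (submod M) (restr_pred M L)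
    (restr_pred_zmod_closed M L).

(* M / (M :&: L), that is, M / L when L is contained in M. *)
Definition factor_module (V : zmodType) (M L : zmodClosed V) : zmodType :=
  quotmod (V := submod M) (restr_pred M L).

Definition noetherian (V : zmodType) : Prop :=
  forall N : nat -> zmodClosed V,
    (forall i, {subset N i <= N i.+1}) ->
    exists n, forall m, (n <= m)%N -> N m =i N n.

Definition artinian (V : zmodType) : Prop :=
  forall N : nat -> zmodClosed V,
    (forall i, {subset N i.+1 <= N i}) ->
    exists n, forall m, (n <= m)%N -> N m =i N n.

Definition minimax (V : zmodType) : Prop :=
  exists (n : nat) (M : nat -> zmodClosed V),
    [/\ M 0%N =i pred1 0,
        M n =i predT &
        forall i, (i < n)%N ->
          {subset M i <= M i.+1} /\
          (noetherian (factor_module (M i.+1) (M i)) \/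
           artinian (factor_module (M i.+1) (M i)))].

(* A right ZG-module, presented as an abelian group on which G acts on the
   right by additive maps; ZG then acts by Z-linear extension. *)
HB.mixin Record isZGModule (G : groupType) A of GRing.Zmodule A := {
  zgact : A -> G -> A;
  zgact1 : forall a, zgact a 1%g = a;
  zgactM : forall a g h, zgact a (g * h)%g = zgact (zgact a g) h;
  zgactD : forall a b g, zgact (a + b) g = zgact a g + zgact b g
}.

#[short(type="zgModType")]
HB.structure Definition ZGModule (G : groupType) :=
  {A of isZGModule G A & GRing.Zmodule A}.

Section Centralisers.
Variables (G : groupType) (A : zgModType G).
Implicit Type H : set G.

Definition centm_pred H : {pred A} :=
  [pred a | `[< forall h, H h -> zgact a h = a >]].

Lemma centm_zmod_closed H : zmod_closed (centm_pred H).
Proof.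
have act0 (g : G) : zgact (0 : A) g = 0.
  by apply: (@addrI _ (zgact 0 g)); rewrite -zgactD !addr0.
have actN (a : A) g : zgact (- a) g = - zgact a g.
  by apply: (@addrI _ (zgact a g)); rewrite -zgactD !subrr act0.
split=> [|a b /asboolP aH /asboolP bH]; apply/asboolP => h Hh //.
by rewrite zgactD actN aH ?bH.
Qed.

HB.instance Definition _ H :=
  GRing.isZmodClosed.Build A (centm_pred H) (centm_zmod_closed H).

(* C_A(H) *)
Definition centm H : zmodClosed A :=
  GRing.ZmodClosed.clone A (centm_pred H) _.

(* C_G(A) *)
Definition centg : set G := [set g | forall a : A, zgact a g = a].

End Centralisers.

Arguments centm {G} A H.
Arguments centg {G} A.

Definition primary_pred (V : zmodType) (q : nat) : {pred V} :=
  [pred x | `[< exists n, x *+ (q ^ n) = 0 >]].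
Arguments primary_pred : clear implicits.

Lemma primary_zmod_closed (V : zmodType) (q : nat) :
  zmod_closed (primary_pred V q).
Proof.
split=> [|x y /asboolP[n xn] /asboolP[m ym]]; apply/asboolP.
  by exists 0%N; rewrite mul0rn.
exists (n + m)%N; rewrite mulrnBl expnD mulrnA xn mul0rn.
by rewrite mulnC mulrnA ym mul0rn subrr.
Qed.

HB.instance Definition _ (V : zmodType) (q : nat) :=
  GRing.isZmodClosed.Build V (primary_pred V q) (@primary_zmod_closed V q).

Definition primary (V : zmodType) (q : nat) : zmodClosed V :=
  GRing.ZmodClosed.clone V (primary_pred V q) _.
Arguments primary : clear implicits.

Definition int_pred : {pred rat} := [pred x | x \is a Num.int].

Lemma int_pred_zmod_closed : zmod_closed int_pred.
Proof. by split=> [|x y]; rewrite !inE ?rpred0 //; apply: rpredB. Qed.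

HB.instance Definition _ :=
  GRing.isZmodClosed.Build rat int_pred int_pred_zmod_closed.

Definition rat_mod_int : zmodType := quotmod (V := rat) int_pred.

(* The Pruefer group, written additively; meaningful for q prime. *)
Definition quasi_cyclic (q : nat) : zmodType := submod (primary rat_mod_int q).

(* Isomorphism from a multiplicative group onto an additive one. *)
Definition isomorphic_to (G : groupType) (V : zmodType) : Prop :=
  exists f : G -> V, bijective f /\ forall x y, f (x * y)%g = f x + f y.

(* Main.v *)
From HB Require Import structures.
Require Import Defs.
From mathcomp Require Import all_boot all_order all_algebra.
From mathcomp Require Import all_classical.

(** The hypotheses enter only through two consequences.

    First, no two proper subgroups [H], [K] generate [G]: otherwise
    C_A(G) = C_A(H) :&: C_A(K), and A / C_A(G) would embed into the sum of the
    minimax modules A / C_A(H) and A / C_A(K).  A group with this property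
    ([join_irreducible]) that is infinite is not cyclic, hence has no proper
    subgroup of finite index, since it would be generated by that subgroup and
    finitely many elements, which can be discarded one at a time.

    Second, a group without proper subgroups of finite index acts trivially on
    every finite invariant section of [A].  Let [N] be a proper normal subgroup
    and W = A / C_A(N).  As W is minimax, W[n] and W / n W are finite for every
    n > 0 ([bounded_finite]), so [G] centralises the torsion of W and every
    W / n W; and there is an m such that the intersection of the m ^ k W is
    torsion ([coprime_reduced]).  Hence [A, G, G] <= C_A(N).  Every element of
    [G] lies in a proper normal subgroup, namely the one that it generates
    together with G', so [A, G, G] <= C_A(G) ([unipotent]).

    Unipotence and faithfulness make all commutators central, so that
    commutation is bilinear on G / G'.  The join-irreducible group G / G' is a
    torsion group and divisible ([torsion], [divisible]), and a bilinear map
    from such a group is zero: with n x = 0 and y = n z we get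
    (x, y) = (n x, z) = 0.  Thus [G] is abelian, and it remains to see that a
    join-irreducible abelian group that is neither trivial nor cyclic is a
    Pruefer group ([prufer_basis], [prufer_iso]).  Zorn's lemma gives subgroups
    that are maximal among those avoiding an element; their quotients are
    primary groups with a least nonzero subgroup, and join-irreducibility
    transfers this to the group itself. *)

Set Implicit Arguments.
Unset Strict Implicit.
Unset Printing Implicit Defensive.

Import GRing.Theory Num.Theory.
Local Open Scope classical_set_scope.
Local Open Scope ring_scope.

(** * Chains between two subgroups of an abelian group *)

Section Zsub.
Variable V : zmodType.
Implicit Types (S P Q R M U : set V) (x : V).

Lemma subrACA (x y z t : V) : (x - y) - (z - t) = (x - z) - (y - t).
Proof. by rewrite opprD addrACA -opprD. Qed.

Definition zsub S := S 0 /\ forall x y, S x -> S y -> S (x - y).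

Lemma zsubN S x : zsub S -> S x -> S (- x).
Proof. by case=> S0 SB Sx; rewrite -sub0r; apply: SB. Qed.

Lemma zsubD S x y : zsub S -> S x -> S y -> S (x + y).
Proof. by move=> zS Sx /(zsubN zS) Sy; rewrite -[y]opprK; apply: zS.2. Qed.

Lemma zsubMn S x n : zsub S -> S x -> S (x *+ n).
Proof.
move=> zS Sx; elim: n => [|n IHn]; first by rewrite mulr0n; apply: zS.1.
by rewrite mulrS; apply: zsubD.
Qed.

Lemma zsubMz S x (k : int) : zsub S -> S x -> S (x *~ k).
Proof.
move=> zS Sx; case: k => n; first exact: zsubMn.
by rewrite NegzE mulrNz; apply: zsubN => //; apply: zsubMn.
Qed.

Lemma zsub_addr S x y : zsub S -> S y -> S (x + y) -> S x.
Proof. by move=> zS Sy Sxy; rewrite -[x](addrK y); apply: zS.2. Qed.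

Lemma zsubI S P : zsub S -> zsub P -> zsub (S `&` P).
Proof.
move=> zS zP; split; first by split; [apply: zS.1 | apply: zP.1].
by move=> x y [Sx Px] [Sy Py]; split; [apply: zS.2 | apply: zP.2].
Qed.

Lemma zsub_zero : zsub [set 0].
Proof. by split=> // x y -> ->; rewrite subr0. Qed.

Lemma zsub_absz S x (k : int) : zsub S -> S (x *~ k) -> S (x *+ `|k|).
Proof.
by move=> zS Sk; rewrite pmulrn abszEsign mulrC mulrzA; apply: zsubMz.
Qed.

Lemma zsub_coprime S x m n :
  zsub S -> coprime m n -> S (x *+ m) -> S (x *+ n) -> S x.
Proof.
move=> zS co Sm Sn.
have /coprimezP[[u v] /= uv] : coprimez m n by rewrite coprimezE.
rewrite -[x]mulr1z -uv mulrzDr ![_ * _%:Z]mulrC !mulrzA -!pmulrn.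
by apply: zsubD => //; apply: zsubMz.
Qed.

Lemma zsub_prime S x (k : int) (p : nat) : zsub S -> prime p ->
  S (x *~ k) -> S (x *+ p) -> ~~ (p %| k)%Z -> S x.
Proof.
move=> zS pp Sk Sp npk; apply: (zsub_coprime zS _ (zsub_absz zS Sk) Sp).
by rewrite coprime_sym prime_coprime.
Qed.

Definition zcyc x : set V := [set y | exists k : int, y = x *~ k].

Lemma zsub_zcyc x : zsub (zcyc x).
Proof.
split=> [|_ _ [k ->] [l ->]]; first by exists 0; rewrite mulr0z.
by exists (k - l); rewrite mulrzBr.
Qed.

Lemma zcyc_id x : zcyc x x.
Proof. by exists 1; rewrite mulr1z. Qed.

Definition multiples n S : set V := [set x *+ n | x in S].

Lemma zsub_multiples n S : zsub S -> zsub (multiples n S).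
Proof.
move=> zS; split=> [|_ _ [x Sx <-] [y Sy <-]].
  by exists 0; [exact: zS.1 | rewrite mul0rn].
by exists (x - y); [exact: zS.2 | rewrite mulrnBl].
Qed.

Definition zadd S P : set V := [set z | exists x y, [/\ S x, P y & z = x + y]].

Lemma zsub_zadd S P : zsub S -> zsub P -> zsub (zadd S P).
Proof.
move=> zS zP; split.
  by exists 0, 0; rewrite addr0; split; [exact: zS.1 | exact: zP.1 |].
move=> _ _ [x [y [Sx Py ->]]] [x' [y' [Sx' Py' ->]]].
exists (x - x'), (y - y'); split; [exact: zS.2 | exact: zP.2 |].
by rewrite opprD addrACA.
Qed.

Lemma zaddl S P : zsub P -> S `<=` zadd S P.
Proof. by move=> [P0 _] x Sx; exists x, 0; rewrite addr0. Qed.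

Lemma zaddr S P : zsub S -> P `<=` zadd S P.
Proof. by move=> [S0 _] x Px; exists 0, x; rewrite add0r. Qed.

Definition boolset S : {pred V} := [pred x | `[< S x >]].

Lemma zsub_closed S : zsub S -> zmod_closed (boolset S).
Proof.
move=> zS; split=> [|x y /asboolP Sx /asboolP Sy]; apply/asboolP.
  exact: zS.1.
exact: zS.2.
Qed.

Definition closed_of S (zS : zsub S) : zmodClosed V :=
  HB.pack (boolset S)
    (GRing.isZmodClosed.Build V (boolset S) (zsub_closed zS)).

Lemma closed_ofE S (zS : zsub S) x : (x \in closed_of zS) = `[< S x >].
Proof. by []. Qed.

Lemma zsub_of (S : zmodClosed V) : zsub [set x | x \in S].
Proof. by split=> [|x y] /=; [apply: rpred0 | apply: rpredB]. Qed.

(** The chain conditions of Q / P, read on the subgroups between [P] and [Q]: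
    sections of one fixed group are composed, intersected and compared without
    transport between subquotient types. *)
Definition noetherian_between P Q := forall N : nat -> set V,
  (forall i, [/\ zsub (N i), P `<=` N i & N i `<=` Q]) ->
  (forall i, N i `<=` N i.+1) ->
  exists n, forall m, (n <= m)%N -> N m `<=` N n.

Definition artinian_between P Q := forall N : nat -> set V,
  (forall i, [/\ zsub (N i), P `<=` N i & N i `<=` Q]) ->
  (forall i, N i.+1 `<=` N i) ->
  exists n, forall m, (n <= m)%N -> N n `<=` N m.

Inductive minimax_between P : set V -> Prop :=
| minimax_refl : minimax_between P P
| minimax_step Q R : minimax_between P Q -> zsub Q -> zsub R -> Q `<=` R ->
    noetherian_between Q R \/ artinian_between Q R -> minimax_between P R.

Lemma minimax_between_trans P Q R :
  minimax_between P Q -> minimax_between Q R -> minimax_between P R.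
Proof.
move=> PQ; elim=> // M N _ PM zM zN MN h.
exact: minimax_step PM zM zN MN h.
Qed.

Lemma chain_homo (N : nat -> set V) : (forall i, N i `<=` N i.+1) ->
  forall i j, (i <= j)%N -> N i `<=` N j.
Proof.
move=> h i; elim=> [|j IHj]; first by rewrite leqn0 => /eqP->.
rewrite leq_eqVlt => /orP[/eqP->//|]; rewrite ltnS => /IHj ij.
exact: subset_trans (h j).
Qed.

Lemma chain_anti (N : nat -> set V) : (forall i, N i.+1 `<=` N i) ->
  forall i j, (i <= j)%N -> N j `<=` N i.
Proof.
move=> h i; elim=> [|j IHj]; first by rewrite leqn0 => /eqP->.
rewrite leq_eqVlt => /orP[/eqP->//|]; rewrite ltnS => /IHj ij.
exact: subset_trans (h j) ij.
Qed.

(** The modular law, in the form that makes [N + P] determine [N] when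
    [P `&` U <= N <= U]. *)
Lemma sub_of_zadd P U N N' : zsub N -> zsub U -> P `&` U `<=` N ->
  N `<=` U -> N' `<=` U -> N' `<=` zadd N P -> N' `<=` N.
Proof.
move=> zN zU PN NU NU' h x Nx; have [y [z [Ny Pz xE]]] := h x Nx.
rewrite xE; apply: zsubD => //; apply: PN; split=> //.
have -> : z = x - y by rewrite xE addrC addKr.
by apply: zU.2; [apply: NU' | apply: NU].
Qed.

(** (Q :&: U) / (P :&: U) embeds into Q / P: chains of the former are carried
    to chains of the latter by adding [P]. *)
Lemma noetherian_betweenI P Q U :
  zsub P -> P `<=` Q -> zsub Q -> zsub U ->
  noetherian_between P Q -> noetherian_between (P `&` U) (Q `&` U).
Proof.
move=> zP PQ zQ zU h N Nh Ni.
have [|i|n hn] := h (fun i => zadd (N i) P).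
- move=> i; have [zN PN NQ] := Nh i; split.
  + exact: zsub_zadd.
  + exact: zaddr.
  + by move=> _ [x [y [/NQ[Qx _] /PQ Py ->]]]; apply: zsubD.
- by move=> _ [x [y [/Ni Nx Py ->]]]; exists x, y.
exists n => m nm.
have [zN PN NQ] := Nh n; have [_ _ NQm] := Nh m.
apply: (sub_of_zadd zN zU PN) => [x /NQ[]|x /NQm[]|x Nx] //.
by apply: (hn m nm); apply: zaddl.
Qed.

Lemma artinian_betweenI P Q U :
  zsub P -> P `<=` Q -> zsub Q -> zsub U ->
  artinian_between P Q -> artinian_between (P `&` U) (Q `&` U).
Proof.
move=> zP PQ zQ zU h N Nh Ni.
have [|i|n hn] := h (fun i => zadd (N i) P).
- move=> i; have [zN PN NQ] := Nh i; split.
  + exact: zsub_zadd.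
  + exact: zaddr.
  + by move=> _ [x [y [/NQ[Qx _] /PQ Py ->]]]; apply: zsubD.
- by move=> _ [x [y [/Ni Nx Py ->]]]; exists x, y.
exists n => m nm.
have [zN PN NQ] := Nh m; have [_ _ NQn] := Nh n.
apply: (sub_of_zadd zN zU PN) => [x /NQ[]|x /NQn[]|x Nx] //.
by apply: (hn m nm); apply: zaddl.
Qed.

Lemma minimax_betweenI P Q U : zsub P -> zsub U ->
  minimax_between P Q -> minimax_between (P `&` U) (Q `&` U).
Proof.
move=> zP zU; elim=> [|M N _ IH zM zN MN h]; first exact: minimax_refl.
apply: minimax_step IH _ _ _ _; [exact: zsubI | exact: zsubI | exact: setSI |].
by case: h => h;
  [left; apply: noetherian_betweenI | right; apply: artinian_betweenI].
Qed.

End Zsub.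

(** * Minimax quotients as chains between subgroups *)

Section Correspondence.
Variables (V X : zmodType) (P Q : set V) (R : V -> X -> Prop).

(** [R] is the graph of an additive map from [Q] onto [X] with kernel [P].  A
    relation is used because [Q] is a subset of [V] and not a type: this covers
    in one step both the quotient map and the passage to a submodule. *)
Record epi_graph : Prop := EpiGraph {
  epiB : forall a b x y, R a x -> R b y -> R (a - b) (x - y);
  epi_ker : forall a, R a 0 <-> P a;
  epi_fun : forall x, R 0 x -> x = 0;
  epi_surj : forall x, exists a, R a x;
  epi_dom : forall a, Q a <-> exists x, R a x }.

Hypothesis RP : epi_graph.

Let pull (S : set X) : set V := [set a | exists2 x, R a x & S x].
Let push (S : set V) : set X := [set x | exists2 a, R a x & S a].

Let R0 : R 0 0.
Proof.
by have [a Ra] := epi_surj RP 0; have := epiB RP Ra Ra; rewrite !subrr.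
Qed.

Let zpull S : zsub S -> [/\ zsub (pull S), P `<=` pull S & pull S `<=` Q].
Proof.
move=> zS; split.
- split=> [|a b [x ax Sx] [y yb Sy]].
    by exists 0; [exact: R0 | exact: zS.1].
  by exists (x - y); [apply: epiB | apply: zS.2].
- by move=> a /(epi_ker RP) a0; exists 0 => //; apply: zS.1.
- by move=> a [x ax _]; apply/(epi_dom RP); exists x.
Qed.

Let zpush S : zsub S -> zsub (push S).
Proof.
move=> zS; split=> [|a b [x ax Sx] [y yb Sy]].
  by exists 0; [exact: R0 | exact: zS.1].
by exists (x - y); [apply: epiB | apply: zS.2].
Qed.

Let pushS S a : zsub S -> P `<=` S -> S `<=` Q ->
  S a <-> exists2 x, R a x & push S x.
Proof.
move=> zS PS SQ; split=> [Sa|[x ax [b bx Sb]]].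
  have /SQ/(epi_dom RP)[x ax] := Sa; exists x => //; exists a => //.
have /(epi_ker RP)/PS : R (a - b) 0 by rewrite -(subrr x); apply: epiB.
by move/(zsubD zS Sb); rewrite subrKC.
Qed.

Let pullS S x : S x <-> exists2 a, R a x & pull S a.
Proof.
split=> [Sx|[a ax [y ay Sy]]].
  by have [a ax] := epi_surj RP x; exists a => //; exists x.
have: R 0 (x - y) by rewrite -(subrr a); apply: epiB.
by move/(epi_fun RP)/subr0_eq->.
Qed.

Lemma noetherian_epi_graph : noetherian X <-> noetherian_between P Q.
Proof.
split=> [h N Nh Ni|h N Ni].
  pose zN i : zsub (N i) := let: And3 z _ _ := Nh i in z.
  have [|n hn] := h (fun i => closed_of (zpush (zN i))).
    move=> i x; rewrite !closed_ofE => /asboolP[a ax Na].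
    by apply/asboolP; exists a => //; apply: Ni.
  exists n => m nm a.
  have [_ PNn NnQ] := Nh n; have [_ PNm NmQ] := Nh m.
  move/(pushS _ (zN m) PNm NmQ) => [x ax xm]; apply/(pushS _ (zN n) PNn NnQ).
  exists x => //; have := hn m nm x; rewrite !closed_ofE => e.
  by apply/asboolP; rewrite -e; apply/asboolP.
have [|i|n hn] := h (fun i => pull [set x | x \in N i]).
- by move=> i; apply: zpull; apply: zsub_of.
- by move=> a [x ax xN]; exists x => //; apply: Ni.
exists n => m nm x; apply/idP/idP; last first.
  exact: (@chain_homo _ (fun i => [set x | x \in N i]) Ni n m nm x).
move=> xm; apply/(pullS [set x | x \in N n]).
have /pullS[a ax xa] : [set x | x \in N m] x by [].
by exists a => //; apply: (hn m).
Qed.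

Lemma artinian_epi_graph : artinian X <-> artinian_between P Q.
Proof.
split=> [h N Nh Ni|h N Ni].
  pose zN i : zsub (N i) := let: And3 z _ _ := Nh i in z.
  have [|n hn] := h (fun i => closed_of (zpush (zN i))).
    move=> i x; rewrite !closed_ofE => /asboolP[a ax Na].
    by apply/asboolP; exists a => //; apply: Ni.
  exists n => m nm a.
  have [_ PNn NnQ] := Nh n; have [_ PNm NmQ] := Nh m.
  move/(pushS _ (zN n) PNn NnQ) => [x ax xm]; apply/(pushS _ (zN m) PNm NmQ).
  exists x => //; have := hn m nm x; rewrite !closed_ofE => e.
  by apply/asboolP; rewrite e; apply/asboolP.
have [|i|n hn] := h (fun i => pull [set x | x \in N i]).
- by move=> i; apply: zpull; apply: zsub_of.
- by move=> a [x ax xN]; exists x => //; apply: Ni.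
exists n => m nm x; apply/idP/idP.
  exact: (@chain_anti _ (fun i => [set x | x \in N i]) Ni n m nm x).
move=> xm; apply/(pullS [set x | x \in N m]).
have /pullS[a ax xa] : [set x | x \in N n] x by [].
by exists a => //; apply: (hn m).
Qed.

End Correspondence.

Section Quotmod.
Variables (A : zmodType) (L : zmodClosed A).

Definition qpi (a : A) : quotmod L := \pi_(quotmod L)%qT a.

Lemma qpiB a b : qpi (a - b) = qpi a - qpi b.
Proof. exact: raddfB. Qed.

Lemma qpiD a b : qpi (a + b) = qpi a + qpi b.
Proof. exact: raddfD. Qed.

Lemma qpiMn a n : qpi (a *+ n) = qpi a *+ n.
Proof. exact: raddfMn. Qed.

Lemma qpi0 : qpi 0 = 0.
Proof. by rewrite -(subrr 0) qpiB subrr. Qed.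

Lemma qpi_eq0 a : qpi a = 0 <-> a \in L.
Proof.
rewrite -qpi0 -[a in a \in L]subr0; split; last first.
  by move=> aL; apply/eqP; rewrite /qpi -Quotient.idealrBE.
by move/eqP; rewrite /qpi -Quotient.idealrBE.
Qed.

Lemma qpi_surj x : exists a, qpi a = x.
Proof. by exists (repr x); apply: reprK. Qed.

Definition qpre (S : set (quotmod L)) : set A := [set a | S (qpi a)].
Definition qimg (S : set A) : set (quotmod L) := [set qpi a | a in S].

Lemma zsub_qpre S : zsub S -> zsub (qpre S).
Proof.
move=> zS; split=> [|a b Sa Sb]; first by rewrite /qpre/= qpi0; apply: zS.1.
by rewrite /qpre/= qpiB; apply: zS.2.
Qed.

Lemma zsub_qimg S : zsub S -> zsub (qimg S).
Proof.
move=> zS; split=> [|_ _ [a Sa <-] [b Sb <-]].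
  by exists 0; [exact: zS.1 | exact: qpi0].
by exists (a - b); [exact: zS.2 | exact: qpiB].
Qed.

Lemma qpre_qimg S a : zsub S -> [set x | x \in L] `<=` S ->
  qimg S (qpi a) <-> S a.
Proof.
move=> zS LS; split=> [[b Sb ba]|Sa]; last by exists a.
have /LS Sab: a - b \in L by apply/qpi_eq0; rewrite qpiB ba subrr.
by rewrite -(subrKC b a); apply: zsubD.
Qed.

End Quotmod.

Section Factor.
Variables (A : zmodType) (L : zmodClosed A).

Lemma factor_graph (M M' : zmodClosed (quotmod L)) (P Q : set A) :
  (forall a, P a <-> qpi L a \in M) -> (forall a, Q a <-> qpi L a \in M') ->
  P `<=` Q ->
  epi_graph P Q (fun a (x : factor_module M' M) =>
    exists2 q : submod M', val q = qpi L a & qpi (restr_pred M' M) q = x).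
Proof.
move=> PM QM PQ; split.
- move=> a b _ _ [q qa <-] [r rb <-]; exists (q - r); last exact: qpiB.
  by rewrite raddfB /= qpiB; congr (_ - _).
- move=> a; split=> [[q qa /qpi_eq0]|Pa].
    by rewrite inE qa => /PM.
  have aM' : qpi L a \in M' by apply/QM/PQ.
  exists (Sub (qpi L a) aM'); first by rewrite SubK.
  by apply/qpi_eq0; rewrite inE SubK; apply/PM.
- move=> x [q q0 <-]; apply/qpi_eq0; rewrite inE q0 qpi0; exact: rpred0.
- move=> x; have [q <-] := qpi_surj x; have [a ax] := qpi_surj (val q).
  by exists a, q.
- move=> a; split=> [/QM aM'|[x [q qa _]]]; last first.
    by apply/QM; rewrite -qa; apply: valP.
  pose q : submod M' := Sub (qpi L a) aM'.
  by exists (qpi (restr_pred M' M) q), q; rewrite // SubK.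
Qed.

Lemma minimax_between_chain (P Q : set A) : zsub P -> minimax_between P Q ->
  exists n (N : nat -> set A), [/\ N 0%N = P, N n = Q,
    forall i, zsub (N i) /\ P `<=` N i &
    forall i, (i < n)%N -> N i `<=` N i.+1 /\
      (noetherian_between (N i) (N i.+1) \/ artinian_between (N i) (N i.+1))].
Proof.
move=> zP; elim=> [|M R PM [n [N [N0 Nn zN Nh]]] zM zR MR h].
  by exists 0%N, (fun=> P); split=> // i; split.
exists n.+1, (fun i => if (i <= n)%N then N i else R); split.
- by [].
- by rewrite ltnn.
- move=> i; case: ifP => // _; split=> //; apply: subset_trans MR; rewrite -Nn.
  by have [_] := zN n.
- move=> i; rewrite ltnS => lein; rewrite lein.
  move: lein; rewrite leq_eqVlt => /orP[/eqP->|ltin].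
    by rewrite ltnn Nn.
  by rewrite ltin; apply: Nh.
Qed.

Lemma minimax_quotmod :
  minimax (quotmod L) <-> minimax_between [set a | a \in L] [set: A].
Proof.
have zL := zsub_of L.
split=> [[n [M [M0 Mn Mh]]]|/(minimax_between_chain zL)[n [N [N0 Nn zN Nh]]]].
  pose N i : set A := qpre [set x | x \in M i].
  have zN i : zsub (N i) by apply/zsub_qpre/zsub_of.
  have N0 : N 0%N = [set a | a \in L].
    apply/seteqP; split=> a; rewrite /N /qpre /= M0 inE.
      by move/eqP/qpi_eq0.
    by move=> aL; apply/eqP/qpi_eq0.
  have Nn : N n = setT by apply/seteqP; split=> // a _; rewrite /N /qpre /= Mn.
  rewrite -N0 -Nn; move: (leqnn n); move: {1 3}n => i; elim: i => [|i IHi] lein.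
    exact: minimax_refl.
  have [MM h] := Mh i lein; have NN: N i `<=` N i.+1 by move=> a; apply: MM.
  apply: (minimax_step (IHi (ltnW lein))) => //.
  have R := @factor_graph (M i) (M i.+1) (N i) (N i.+1)
    (fun=> iff_refl _) (fun=> iff_refl _) NN.
  by case: h => h; [left; apply/(noetherian_epi_graph R)
                  | right; apply/(artinian_epi_graph R)].
pose M i := closed_of (zsub_qimg L (zN i).1).
have NM i a : N i a <-> qpi L a \in M i.
  have [zNi LN] := zN i; rewrite closed_ofE; split=> [Na|/asboolP].
    by apply/asboolP; exists a.
  by move/qpre_qimg; apply=> //; rewrite -N0; have := (zN 0%N).2; rewrite N0.
exists n, M; split.
- move=> x; have [a <-] := qpi_surj x; apply/idP/idP.
    by move/NM; rewrite N0 inE => /qpi_eq0->.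
  by rewrite inE => /eqP/qpi_eq0 aL; apply/NM; rewrite N0.
- by move=> x; have [a <-] := qpi_surj x; rewrite inE; apply/NM; rewrite Nn.
- move=> i ltin; have [NN h] := Nh i ltin.
  split=> [x|]; first by have [a <-] := qpi_surj x => /NM/NN/NM.
  have R := @factor_graph (M i) (M i.+1) (N i) (N i.+1) (NM i) (NM i.+1) NN.
  by case: h => h; [left; apply/(noetherian_epi_graph R)
                  | right; apply/(artinian_epi_graph R)].
Qed.

End Factor.

(** * Bounded sections of minimax modules are finite *)

Section BoundedSections.
Variable V : zmodType.
Implicit Types (S P Q R L M K : set V).

Definition finite_mod L M :=
  exists s : seq V, forall v, M v -> exists2 w, w \in s & L (v - w).

Lemma finite_mod_trans L K M :
  finite_mod L K -> finite_mod K M -> finite_mod L M.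
Proof.
move=> [s sP] [t tP]; exists [seq u + w | u <- s, w <- t] => v /tP[w wt].
move=> /sP[u us Lu]; exists (u + w); first exact: allpairs_f.
by rewrite opprD addrA addrAC.
Qed.

Lemma finite_mod_sub L M : M `<=` L -> finite_mod L M.
Proof.
by move=> ML; exists [:: 0] => v /ML Lv; exists 0; rewrite ?inE ?subr0.
Qed.

Lemma finite_mod_in L M : zsub L -> finite_mod L M ->
  exists2 s : seq V, {in s, forall w, M w} &
    forall v, M v -> exists2 w, w \in s & L (v - w).
Proof.
move=> zL [s sP].
pose Q w (o : option V) := if o is Some r then M r /\ L (r - w)
  else ~ exists r, M r /\ L (r - w).
have [f fP] : {f : V -> option V & forall w, Q w (f w)}.
  apply: (@choice _ _ Q) => w.
  have [[r hr]|h] := pselect (exists r, M r /\ L (r - w)); last by exists None.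
  by exists (Some r).
exists (pmap f s) => [r|v Mv].
  rewrite mem_pmap => /mapP[w _]; have := fP w.
  by case: (f w) => // ? [? _] [->].
have [w ws Lw] := sP v Mv; have := fP w; case E: (f w) => [r|]; last first.
  by case; exists v.
move=> [Mr Lr]; exists r; first by rewrite mem_pmap; apply/mapP; exists w.
rewrite -(subrKA w v (- r)) addrC; apply: zsubD => //.
by rewrite -opprB; apply: zsubN.
Qed.

Section Independent.
Variables (L M : set V) (p : nat).
Hypotheses (zL : zsub L) (zM : zsub M) (LM : L `<=` M) (pp : prime p)
  (pML : forall v, M v -> L (v *+ p)).

(* M / L is a vector space over the field with p elements; [comb x c n] is a
   linear combination of the first n vectors of [x], and [span x n] is the
   preimage in [V] of the space that these vectors generate. *)
Let comb (x : nat -> V) (c : nat -> int) n := \sum_(j < n) x j *~ c j.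
Let span x n : set V := [set v | exists c, L (v - comb x c n)].

Let combD x c d n : comb x (fun j => c j + d j) n = comb x c n + comb x d n.
Proof. by rewrite -big_split; apply: eq_bigr => j _; rewrite mulrzDr. Qed.

Let combN x c n : comb x (fun j => - c j) n = - comb x c n.
Proof. by rewrite -sumrN; apply: eq_bigr => j _; rewrite mulrNz. Qed.

Let zspan x n : zsub (span x n).
Proof.
split=> [|v w [c vc] [d wd]].
  by exists (fun=> 0); rewrite /comb big1 ?subr0; first exact: zL.1.
exists (fun j => c j - d j); rewrite (combD x c (fun j => - d j)) combN.
by rewrite subrACA; apply: zL.2.
Qed.

Let Mcomb x c n : (forall j, M (x j)) -> M (comb x c n).
Proof.
move=> Mx; apply: (big_ind M) => [||j _]; first exact: zM.1.
  by move=> *; apply: zsubD.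
exact: zsubMz.
Qed.

Let finite_mod_span x n : (forall j, M (x j)) -> finite_mod L (span x n).
Proof.
move=> Mx; suff [s sP]: exists s : seq V,
    forall c, exists2 w, w \in s & L (comb x c n - w).
  exists s => v [c vc]; have [w ws Lw] := sP c; exists w => //.
  by rewrite -(subrKA (comb x c n)); apply: zsubD.
elim: n => [|n [s sP]].
  exists [:: 0] => c; exists 0; rewrite ?inE // /comb big_ord0 subr0.
  exact: zL.1.
exists [seq w + x n *+ k | w <- s, k <- iota 0 p] => c.
have [w ws Lw] := sP c; exists (w + x n *+ `|(c n %% p)%Z|%N).
  apply: allpairs_f => //; rewrite mem_iota add0n /=.
  have p0 : (p%:Z != 0) by rewrite eqz_nat -lt0n prime_gt0.
  by rewrite -ltz_nat gez0_abs ?modz_ge0 // ltz_pmod // ltz_nat prime_gt0.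
rewrite /comb big_ord_recr /= opprD addrACA; apply: zsubD => //.
have p0 : (p%:Z != 0) by rewrite eqz_nat -lt0n prime_gt0.
rewrite [x n *+ _]pmulrn gez0_abs ?modz_ge0 // -mulrzBr.
rewrite {1}(divz_eq (c n) p) addrK mulrzA -pmulrn; apply: pML.
exact: zsubMz.
Qed.

(* The last coefficient of a combination in L vanishes modulo p, because x n is
   not in the span of its predecessors. *)
Let indep x n c : (forall j, M (x j)) -> (forall j, ~ span x j (x j)) ->
  L (comb x c n) -> forall j, (j < n)%N -> (p %| c j)%Z.
Proof.
move=> Mx xI; elim: n => // n IHn Lc j.
have Lcn : (p %| c n)%Z.
  apply/negP => /negP npc; apply: (xI n).
  have /coprimezP[[u v] /= uv]: coprimez (c n) p.
    by rewrite coprimez_sym coprimezE prime_coprime.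
  exists (fun j => - (u * c j)); rewrite (combN x (fun j => u * c j)) opprK.
  have -> : comb x (fun j => u * c j) n = comb x c n *~ u.
    by rewrite /comb mulrz_suml; apply: eq_bigr => i _; rewrite mulrC mulrzA.
  have Lu := zsubMz u zL Lc.
  rewrite /comb big_ord_recr /= mulrzDl -mulrzA in Lu.
  have -> : x n = x n *~ (c n * u) + x n *+ p *~ v.
    by rewrite pmulrn -mulrzA -mulrzDr mulrC [p%:Z * _]mulrC uv.
  rewrite addrAC; apply: (zsubD zL); last by apply: zsubMz => //; apply: pML.
  by rewrite addrC.
rewrite ltnS leq_eqVlt => /orP[/eqP->//|]; apply: IHn.
move: Lc; rewrite /comb big_ord_recr /=; apply: zsub_addr => //.
have /dvdzP[d ->] := Lcn; rewrite mulrzA -pmulrn; apply: pML; exact: zsubMz.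
Qed.

(* The sequence is built from lists: nxt s is a vector outside of the span of
   the list s, which exists because that span is finite modulo L. *)
Let exists_indep : ~ finite_mod L M ->
  exists x, (forall j, M (x j)) /\ forall j, ~ span x j (x j).
Proof.
move=> nfin; pose spn (s : seq V) := span (nth 0 s) (size s).
have [nxt nxtP] : {nxt : seq V -> V & forall s,
    (forall j, M s`_j) -> M (nxt s) /\ ~ spn s (nxt s)}.
  apply: (@choice _ _ (fun s y => (forall j, M s`_j) -> M y /\ ~ spn s y)) => s.
  have [Ms|] := pselect (forall j, M s`_j); last by exists 0.
  apply: contrapT => h; apply: nfin.
  apply: (finite_mod_trans (finite_mod_span (size s) Ms)).
  apply: finite_mod_sub => v Mv.
  by apply: contrapT => nv; apply: h; exists v.
pose S n := iter n (fun s => rcons s (nxt s)) [::]; pose x n := nxt (S n).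
have SE n : S n = mkseq x n by elim: n => //= n IHn; rewrite mkseqS -IHn.
have MS n j : M (S n)`_j.
  elim: n j => [|n IHn] j; first by rewrite nth_nil; apply: zM.1.
  rewrite /= nth_rcons; case: ifP => // _; case: ifP => _; last exact: zM.1.
  by have [] := nxtP _ IHn.
exists x; split=> j; first by have [] := nxtP _ (MS j).
have [_ nj] := nxtP _ (MS j); case=> c Lc; apply: nj; exists c.
have sS : size (S j) = j by rewrite SE size_mkseq.
suff -> : comb (nth 0 (S j)) c (size (S j)) = comb x c j by [].
by rewrite sS; apply: eq_bigr => i _; rewrite SE nth_mkseq.
Qed.

Lemma noetherian_finite_mod_prime P Q : zsub Q -> P `<=` L -> M `<=` Q ->
  noetherian_between P Q -> finite_mod L M.
Proof.
move=> zQ PL MQ h; apply: contrapT => /exists_indep[x [Mx xI]].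
have [i|i v [c vc]|n hn] := h (span x).
- split; first exact: zspan.
    by move=> v /PL Lv; exists (fun=> 0); rewrite /comb big1 ?subr0.
  move=> v [c vc]; rewrite -(subrK (comb x c i) v).
  by apply: zsubD; [|apply/MQ/LM|apply/MQ/Mcomb].
- exists (fun j => if (j < i)%N then c j else 0).
  rewrite /comb big_ord_recr /= ltnn mulr0z addr0.
  by under eq_bigr do rewrite ltn_ord.
- apply: (xI n); apply: (hn n.+1) => //; exists (fun j => (j == n)%:R).
  rewrite /comb big_ord_recr /= eqxx mulr1z big1 ?add0r ?subrr.
    exact: zL.1.
  by move=> j _; rewrite ltn_eqF.
Qed.

(** An infinite independent sequence has the strictly descending chain of the
    spans of its tails. *)
Lemma artinian_finite_mod_prime P Q : zsub Q -> P `<=` L -> M `<=` Q ->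
  artinian_between P Q -> finite_mod L M.
Proof.
move=> zQ PL MQ h; apply: contrapT => /exists_indep[x [Mx xI]].
pose tl i : set V := [set v | exists n c,
  (forall j, (j < i)%N -> c j = 0) /\ L (v - comb x c n)].
pose trunc n (c : nat -> int) j := if (j < n)%N then c j else 0.
(* Combinations of different lengths are compared at a common length. *)
have pad c n m : (n <= m)%N -> comb x c n = comb x (trunc n c) m.
  rewrite /trunc => nm.
  rewrite /comb (big_ord_widen m (fun j => x j *~ c j) nm) big_mkcond.
  by apply: eq_bigr => j _; case: ifP; rewrite ?mulr0z.
have [i|i v [n [c [c0 vc]]]|n hn] := h tl.
- split.
  + split=> [|v w [n [c [c0 vc]]] [m [d [d0 wd]]]].
      exists 0%N, (fun=> 0); rewrite /comb big_ord0 subr0.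
      by split=> //; apply: zL.1.
    exists (n + m)%N, (fun j => trunc n c j - trunc m d j); split.
      move=> j ji; rewrite /trunc c0 // d0 //.
      by do 2 case: ifP; rewrite ?subr0.
    rewrite (combD x (trunc n c) (fun j => - trunc m d j)) combN.
    rewrite -!pad ?leq_addr ?leq_addl //.
    by rewrite subrACA; apply: zL.2.
  + by move=> v /PL Lv; exists 0%N, (fun=> 0); rewrite /comb big_ord0 subr0.
  + move=> v [n [c [_ vc]]]; rewrite -(subrK (comb x c n) v).
    by apply: zsubD; [|apply/MQ/LM|apply/MQ/Mcomb].
- by exists n, c; split=> // j ji; apply: c0; apply: ltnW.
- have [|m [c [c0 Lc]]] := hn n.+1 (leqnSn n) (x n).
    exists n.+1, (fun j => (j == n)%:R).
    split; first by move=> j jn; rewrite ltn_eqF.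
    rewrite /comb big_ord_recr /= eqxx mulr1z big1 ?add0r ?subrr.
      exact: zL.1.
    by move=> j _; rewrite ltn_eqF.
  (* x n minus a combination of later vectors has coefficient 1 at x n. *)
  have nm : (n < n.+1 + m)%N by rewrite addSn ltnS leq_addr.
  pose c1 j : int := (j == n)%:R - trunc m c j.
  have := @indep x (n.+1 + m) c1 Mx xI _ n nm.
  rewrite {2}/c1 eqxx /trunc c0 // if_same subr0 => H.
  suff /H : L (comb x c1 (n.+1 + m)).
    by rewrite dvdz1 /= => /eqP p1; move: pp; rewrite p1.
  rewrite (combD x _ (fun j => - trunc m c j)) combN -pad ?leq_addl //.
  suff -> : comb x (fun j => (j == n)%:R) (n.+1 + m) = x n by [].
  rewrite /comb (bigD1 (Ordinal nm)) //= eqxx mulr1z big1 ?addr0 // => j jn.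
  by rewrite -val_eqE /= in jn; rewrite (negPf jn).
Qed.

End Independent.

(** Quantifying over all sections between [P] and [Q], and not only over the
    n-torsion and the quotient by n, is what makes the property stable under
    extensions. *)
Definition bounded_finite P Q := forall L M n,
  zsub L -> zsub M -> P `<=` L -> L `<=` M -> M `<=` Q -> (0 < n)%N ->
  (forall v, M v -> L (v *+ n)) -> finite_mod L M.

(** With p a prime divisor of n, the quotient M / (p M + L) has exponent p and
    (p M + L) / L has exponent n / p. *)
Lemma bounded_finite_prime P Q :
  (forall L M p, zsub L -> zsub M -> P `<=` L -> L `<=` M -> M `<=` Q ->
    prime p -> (forall v, M v -> L (v *+ p)) -> finite_mod L M) ->
  bounded_finite P Q.
Proof.
move=> h L M n; elim/ltn_ind: n L M => n IHn L M zL zM PL LM MQ n0 nML.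
have [n1|n1] := leqP n 1.
  have n_1 : n = 1%N by apply/eqP; rewrite eqn_leq n1.
  by apply: finite_mod_sub => v /nML; rewrite n_1 mulr1n.
have pp := pdiv_prime n1; set p := pdiv n in pp.
have np : n = (p * (n %/ p))%N by rewrite mulnC divnK ?pdiv_dvd.
have zpM : zsub (multiples p M) by apply: zsub_multiples.
pose K := zadd (multiples p M) L; have zK : zsub K by apply: zsub_zadd.
have LK : L `<=` K by apply: zaddr.
have KM : K `<=` M.
  move=> _ [_ [z [[y My <-] Lz ->]]].
  by apply: zsubD => //; [apply: zsubMn | apply: LM].
apply: (@finite_mod_trans L K).
  apply: (IHn (n %/ p)%N) => //.
  - by rewrite ltn_Pdiv // prime_gt1.
  - by apply: subset_trans MQ.
  - by rewrite divn_gt0 ?prime_gt0 // dvdn_leq // pdiv_dvd.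
  - move=> _ [_ [z [[y My <-] Lz ->]]]; rewrite mulrnDl -mulrnA -np.
    by apply: zsubD; [|apply: nML|apply: zsubMn].
apply: (h K M p) => //; first exact: subset_trans LK.
by move=> v Mv; apply: zaddl => //; exists v.
Qed.

(** M / L is an extension of a section between [P] and [Q] by one between [Q]
    and [R]: intersect with [Q], and add [Q]. *)
Lemma bounded_finite_trans P Q R : zsub Q -> P `<=` Q -> Q `<=` R -> zsub R ->
  bounded_finite P Q -> bounded_finite Q R -> bounded_finite P R.
Proof.
move=> zQ PQ QR zR hPQ hQR L M n zL zM PL LM MR n0 nML.
have f1 : finite_mod (L `&` Q) (M `&` Q).
  apply: (hPQ _ _ n) => //; try exact: zsubI.
  - by move=> x Px; split; [apply: PL | apply: PQ].
  - exact: setSI.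
  - by move=> v [Mv Qv]; split; [apply: nML | apply: zsubMn].
have f2 : finite_mod (zadd L Q) (zadd M Q).
  apply: (hQR _ _ n) => //; try exact: zsub_zadd.
  - exact: zaddr.
  - by move=> _ [x [y [/LM Mx Qy ->]]]; exists x, y.
  - by move=> _ [x [y [/MR Rx /QR Ry ->]]]; apply: zsubD.
  - move=> _ [x [y [Mx Qy ->]]]; exists (x *+ n), (y *+ n).
    by rewrite mulrnDl; split; [apply: nML | apply: zsubMn |].
have zLQ : zsub (zadd L Q) by apply: zsub_zadd.
apply: (@finite_mod_trans _ (zadd L (M `&` Q))).
  have [s sP] := f1; exists s => _ [l [q [Ll /sP[w ws [Lw _]] ->]]].
  by exists w => //; rewrite -addrA; apply: zsubD.
have f3 : finite_mod (zadd L Q) M.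
  by have [s sP] := f2; exists s => v Mv; apply: sP; apply: zaddl.
have [s sM sP] := finite_mod_in zLQ f3; exists s => v Mv.
have [w ws [l [q [Ll Qq e]]]] := sP v Mv; exists w => //.
exists l, q; split=> //; split=> //.
have -> : q = v - w - l by rewrite e addrC addKr.
by apply: zM.2; [apply: zM.2 => //; apply: sM | apply: LM].
Qed.

Lemma bounded_finite_minimax P Q : zsub P ->
  minimax_between P Q -> P `<=` Q /\ bounded_finite P Q.
Proof.
move=> zP; elim=> [|M R _ [PM hM] zM zR MR h].
  split=> // L M n zL zM PL LM MP _ _.
  by apply: finite_mod_sub; apply: subset_trans PL.
split; first exact: subset_trans MR.
apply: (@bounded_finite_trans _ M) => //.
apply: bounded_finite_prime => L N p zL zN ML LN NR pp pN.
case: h.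
  exact: (noetherian_finite_mod_prime zL zN LN pp pN zR ML NR).
exact: (artinian_finite_mod_prime zL zN LN pp pN zR ML NR).
Qed.

End BoundedSections.

(** * Intersections of multiples in minimax modules *)

Section Reduced.
Variable V : zmodType.
Implicit Types (S P Q R L M K : set V).

(** For Q / P and all m > 1 prime to some N: there is no m-torsion, and the
    intersection of the multiples by m ^ k is torsion.  The restriction on m is
    forced by the quasi-cyclic and the Z[1/p] modules; the first clause is what
    makes the second one stable under extensions. *)
Definition coprime_reduced P Q :=
  exists2 N, (0 < N)%N & forall m, (1 < m)%N -> coprime m N ->
  (forall v, Q v -> P (v *+ m) -> P v) /\
  (forall v, Q v -> (forall k, exists2 w, Q w & P (v - w *+ (m ^ k))) ->
     exists2 n, (0 < n)%N & P (v *+ n)).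

Lemma no_torsionX P Q m : zsub Q -> (forall v, Q v -> P (v *+ m) -> P v) ->
  forall k v, Q v -> P (v *+ m ^ k) -> P v.
Proof.
move=> zQ h; elim=> [|k IHk] v Qv; first by rewrite expn0 mulr1n.
by rewrite expnSr mulrnA => /h-/(_ (zsubMn _ zQ Qv)); apply: IHk.
Qed.

Lemma torsion_factorial P v n d : zsub P -> (0 < d)%N -> (d <= n)%N ->
  P (v *+ d) -> P (v *+ n`!).
Proof.
move=> zP d0 dn Pd; have /dvdnP[q ->] : (d %| n`!)%N by rewrite dvdn_fact ?d0.
by rewrite mulnC mulrnA; apply: zsubMn.
Qed.

(** The torsion of Q / P is bounded.  If v = m ^ k w_k for all k, then
    w_i = m w_(i+1), and the ascending chain of the <w_i> stops, which yields
    w_(n+1) = c w_n = c m w_(n+1) with c m <> 1. *)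
Lemma coprime_reduced_noetherian P Q :
  zsub P -> zsub Q -> P `<=` Q -> noetherian_between P Q -> coprime_reduced P Q.
Proof.
move=> zP zQ PQ h.
have [i|i v [Qv Pv]|N hN] := h (fun i => [set v | Q v /\ P (v *+ i`!)]).
- split.
  + split=> [|v w [Qv Pv] [Qw Pw]].
      by rewrite /= mul0rn; split; [apply: zQ.1 | apply: zP.1].
    by rewrite /= mulrnBl; split; [apply: zQ.2 | apply: zP.2].
  + by move=> v Pv; split; [apply: PQ | apply: zsubMn].
  + by move=> v [].
- by split=> //; rewrite factS mulnC mulrnA; apply: zsubMn.
exists N`!; first exact: fact_gt0.
move=> m m1 co.
have tors : forall v, Q v -> P (v *+ m) -> P v.
  move=> v Qv Pm; apply: (zsub_coprime zP co) => //.
  apply: (hN (maxn N m) _ v _).2; first exact: leq_maxl.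
  by split=> //; apply: torsion_factorial Pm; rewrite ?leq_maxr // ltnW.
split=> // v Qv vP.
have [w wP] : {w : nat -> V & forall k, Q (w k) /\ P (v - w k *+ m ^ k)}.
  apply: (@choice _ _ (fun k y => Q y /\ P (v - y *+ m ^ k))) => k.
  by have [y] := vP k; exists y.
have wS i : P (w i - w i.+1 *+ m).
  have Qw : Q (w i - w i.+1 *+ m).
    case: (wP i) => Qi _; case: (wP i.+1) => Qi' _.
    by apply: zQ.2 => //; apply: zsubMn.
  apply: (no_torsionX zQ tors Qw (k := i)).
  rewrite mulrnBl -mulrnA -expnS -[_ - _](subrKA v) -opprB.
  by apply: zsubD => //; [apply: zsubN => // | ]; apply (wP _).
have [i|i x [c xc]|n hn] := h (fun i => [set x | exists c, P (x - w i *~ c)]).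
- split.
  + split=> [|x y [c xc] [d yd]].
      by exists 0; rewrite mulr0z subr0; apply: zP.1.
    by exists (c - d); rewrite mulrzBr subrACA; apply: zP.2.
  + by move=> x Px; exists 0; rewrite mulr0z subr0.
  + move=> x [c /PQ xc]; rewrite -(subrK (w i *~ c) x); apply: zsubD => //.
    by apply: zsubMz => //; apply (wP _).
- exists (m%:Z * c); rewrite -(subrKA (w i *~ c)); apply: zsubD => //.
  by rewrite mulrzA -mulrzBl -pmulrn; apply: zsubMz.
have [|c wc] := hn n.+1 (leqnSn n) (w n.+1).
  by exists 1; rewrite mulr1z subrr; apply: zP.1.
pose d := 1 - m%:Z * c.
have Pwd : P (w n.+1 *~ d).
  rewrite /d mulrzBr mulr1z mulrzA -pmulrn -(subrKA (w n *~ c)).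
  apply: zsubD => //.
  by rewrite -mulrzBl; apply: zsubMz.
have d0 : d != 0.
  rewrite subr_eq0; apply/negP => /eqP e.
  have : (m%:Z %| 1)%Z by apply/dvdzP; exists c; rewrite mulrC.
  by rewrite dvdz1 /= => /eqP m1'; rewrite m1' in m1.
exists `|d|%N; first by rewrite absz_gt0.
apply: zsub_absz => //.
rewrite -(subrK (w n.+1 *+ m ^ n.+1) v) mulrzDl; apply: zsubD => //.
  by apply: zsubMz => //; apply (wP _).
by rewrite pmulrn mulrzAC -pmulrn; apply: zsubMn.
Qed.

(** Q / P is torsion, because the chain of the <2 ^ i v> stops; and it has
    p-torsion for finitely many primes p only, because the subgroups of the
    elements whose order is prime to i! form a descending chain. *)
Lemma coprime_reduced_artinian P Q :
  zsub P -> zsub Q -> P `<=` Q -> artinian_between P Q -> coprime_reduced P Q.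
Proof.
move=> zP zQ PQ h.
have tors v : Q v -> exists2 n, (0 < n)%N & P (v *+ n).
  move=> Qv; have [i|i x [c xc]|n hn] :=
    h (fun i => [set x | exists c, P (x - v *~ (c * (2 ^ i)%N%:Z))]).
  - split.
    + split=> [|x y [c xc] [d yd]].
        by exists 0; rewrite mul0r mulr0z subr0; apply: zP.1.
      by exists (c - d); rewrite mulrBl mulrzBr subrACA; apply: zP.2.
    + by move=> x Px; exists 0; rewrite mul0r mulr0z subr0.
    + move=> x [c /PQ xc]; rewrite -(subrK (v *~ (c * (2 ^ i)%N%:Z)) x).
      apply: zsubD => //.
      exact: zsubMz.
  - by exists (c * 2%:Z); rewrite -mulrA -PoszM -expnS.
  have [|c vc] := hn n.+1 (leqnSn n) (v *+ 2 ^ n).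
    by exists 1; rewrite mul1r -pmulrn subrr; apply: zP.1.
  rewrite pmulrn -mulrzBr expnS PoszM mulrA in vc.
  rewrite -[X in v *~ (X - _)]mul1r -mulrBl in vc.
  pose d := (1 - c * 2%:Z) * (2 ^ n)%N.
  have d0 : d != 0.
    rewrite mulf_neq0 // ?subr_eq0; last by rewrite eqz_nat -lt0n expn_gt0.
    apply/negP => /eqP e; have : (2%:Z %| 1)%Z by apply/dvdzP; exists c.
    by rewrite dvdz1.
  by exists `|d|%N; [rewrite absz_gt0 | apply: zsub_absz].
have [i|i v [Qv [m co Pm]]|n hn] :=
  h (fun i => [set v | Q v /\ exists2 m, coprime m i`! & P (v *+ m)]).
- split.
  + split=> [|v w [Qv [m com Pm]] [Qw [l col Pl]]].
      split; first exact: zQ.1.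
      by exists 1%N; [exact: coprime1n | rewrite mul0rn; apply: zP.1].
    split; first exact: zQ.2.
    exists (m * l)%N; first by rewrite coprimeMl com.
    rewrite mulrnBl; apply: zP.2; first by rewrite mulrnA; apply: zsubMn.
    by rewrite mulnC mulrnA; apply: zsubMn.
  + move=> v Pv; split; first exact: PQ.
    by exists 1%N; [exact: coprime1n | rewrite mulr1n].
  + by move=> v [].
- by split=> //; exists m => //; move: co; rewrite factS coprimeMr => /andP[].
exists n`!; first exact: fact_gt0.
move=> m m1 co; split=> [v Qv Pm|v Qv _]; last exact: tors.
have [d d0 Pd] := tors v Qv.
have [|_ [l col Pl]] := hn (maxn n d) (leq_maxl _ _) v.
  by split=> //; exists m.
apply: (zsub_coprime zP _ Pl Pd); apply: coprime_dvdr col.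
by rewrite dvdn_fact // d0 leq_maxr.
Qed.

(** If v is divisible by every m ^ k modulo [P], some multiple of v is in [Q];
    as R / Q has no m-torsion, the corresponding multiples of the quotients of v
    by m ^ k are in [Q] too, and the hypothesis on Q / P applies. *)
Lemma coprime_reduced_trans P Q R :
  zsub P -> zsub Q -> zsub R -> P `<=` Q -> Q `<=` R ->
  coprime_reduced P Q -> coprime_reduced Q R -> coprime_reduced P R.
Proof.
move=> zP zQ zR PQ QR [N N0 hN] [N' N'0 hN'].
exists (N * N')%N; first by rewrite muln_gt0 N0.
move=> m m1; rewrite coprimeMr => /andP[co co'].
have [t d] := hN m m1 co; have [t' d'] := hN' m m1 co'.
split=> [v Rv Pm|v Rv vP].
  by apply: t => //; apply: t' => //; apply: PQ.
have [|n n0 Qvn] := d' v Rv.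
  by move=> k; have [w Rw /PQ] := vP k; exists w.
have [k|n' n'0 Pn'] := d _ Qvn; last first.
  by exists (n * n')%N; rewrite ?muln_gt0 ?n0 // mulrnA.
have [w Rw Pw] := vP k.
have Pwn : P (v *+ n - w *+ n *+ m ^ k).
  by rewrite mulrnAC -mulrnBl; apply: zsubMn.
exists (w *+ n) => //.
apply: (no_torsionX zR t' (zsubMn n zR Rw) (k := k)).
rewrite -[_ *+ m ^ k](subKr (v *+ n)); apply: zQ.2 => //; exact: PQ.
Qed.

Lemma coprime_reduced_minimax P Q :
  zsub P -> minimax_between P Q -> coprime_reduced P Q.
Proof.
move=> zP PQ; suff [] : P `<=` Q /\ coprime_reduced P Q by [].
elim: PQ => [|M R _ [PM hM] zM zR MR h].
  split=> //; exists 1%N => // m m1 _; split=> // v Pv _; exists 1%N => //.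
split; first exact: subset_trans MR.
apply: (@coprime_reduced_trans _ M) => //.
by case: h;
  [apply: coprime_reduced_noetherian | apply: coprime_reduced_artinian].
Qed.

End Reduced.

(** * Groups that two proper subgroups never generate *)

Section GroupJoin.
Variable G : groupType.
Implicit Types (H K L S : set G) (x y g h : G).
Local Open Scope group_scope.

Lemma subgroupP H : subgroup H <-> H 1 /\ forall x y, H x -> H y -> H (x / y).
Proof.
split=> [[H1 Hd]|[H1 Hd]].
  split; first exact: set_mem H1.
  by move=> x y /mem_set Hx /mem_set Hy; apply: set_mem; apply: Hd.
split; first exact: mem_set.
by move=> x y /set_mem Hx /set_mem Hy; apply: mem_set; apply: Hd.
Qed.

Lemma sub1g H : subgroup H -> H 1.
Proof. by case/subgroupP. Qed.

Lemma subVg H x : subgroup H -> H x -> H x^-1.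
Proof. by case/subgroupP => H1 Hd /(Hd _ _ H1); rewrite div1g. Qed.

Lemma subMg H x y : subgroup H -> H x -> H y -> H (x * y).
Proof.
move=> sH Hx /(subVg sH) Hy.
by case/subgroupP: sH => _ /(_ _ _ Hx Hy); rewrite invgK.
Qed.

Lemma subXg H x n : subgroup H -> H x -> H (x ^+ n).
Proof.
move=> sH Hx; elim: n => [|n IHn]; first by rewrite expg0; apply: sub1g.
by rewrite expgS; apply: subMg.
Qed.

Lemma subgroup_generated S : subgroup (generated S).
Proof.
apply/subgroupP; split=> [|x y Sx Sy] K [sK SK]; first exact: sub1g.
have [_ Kd] := (subgroupP K).1 sK; apply: Kd; [exact: Sx | exact: Sy].
Qed.

Lemma sub_generated S : S `<=` generated S.
Proof. exact: sub_gen_smallest. Qed.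

Lemma generated_min S H : subgroup H -> S `<=` H -> generated S `<=` H.
Proof. by move=> sH SH x; apply. Qed.

Lemma commg_derived x y : derived [set: G] [~ x, y].
Proof. by apply: sub_generated; exists x => //; exists y. Qed.

Lemma cycleP x y : generated [set x] y -> exists m n, y = x ^+ m * x ^- n.
Proof.
pose C := [set z | exists m n, z = x ^+ m * x ^- n].
apply: (@generated_min _ C) => [|_ ->]; last first.
  by exists 1%N, 0%N; rewrite expg1 expg0 invg1 mulg1.
apply/subgroupP; split=> [|_ _ [m [n ->]] [m' [n' ->]]].
  by exists 0%N, 0%N; rewrite expg0 invg1 mulg1.
exists (m + n')%N, (n + m')%N.
rewrite expgnDr invgM invgK -!mulgA; congr (_ * _).
rewrite [(n + _)%N]addnC expgnDr invgM !mulgA; congr (_ * _).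
have : commute (x ^+ n') (x ^+ n) by apply: commuteX2.
by move/commuteV; rewrite /commute => ->.
Qed.

Definition join_irreducible := forall H K, subgroup H -> subgroup K ->
  (forall L, subgroup L -> H `<=` L -> K `<=` L -> L = [set: G]) ->
  H = [set: G] \/ K = [set: G].

Hypotheses (infG : infinite_set [set: G]) (irrG : join_irreducible).

Lemma cycle_torsion x d :
  (0 < d)%N -> x ^+ d = 1 -> generated [set x] <> [set: G].
Proof.
move=> d0 xd xT; apply: infG.
apply: (@sub_finite_set _ _ [set x ^+ i | i in `I_d]); last first.
  exact/finite_image/finite_II.
move=> y _; have : generated [set x] y by rewrite xT.
move=> /cycleP[m [n ->]].
exists ((m + n * d.-1) %% d)%N; first by rewrite /= ltn_mod.
have xdM k : x ^+ (k * d) = 1 by rewrite mulnC expgnA xd expg1n.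
have : x ^+ (m + n * d.-1) = x ^+ m * x ^- n.
  rewrite expgnDr; congr (_ * _); apply: (@mulgI _ (x ^+ n)).
  by rewrite mulgV -expgnDr -mulnS prednK // xdM.
by move=> <-; rewrite [in RHS](divn_eq (m + n * d.-1) d) expgnDr xdM mul1g.
Qed.

(** An infinite cyclic group is the join of the subgroups generated by the
    square and by the cube of a generator. *)
Lemma noncyclic x : generated [set x] <> [set: G].
Proof.
move=> xT.
have expB a b : x ^+ a = x ^+ b -> (a < b)%N -> False.
  move=> ab ltab; apply: (@cycle_torsion x (b - a)) => //.
    by rewrite subn_gt0.
  by apply: (@mulgI _ (x ^+ a)); rewrite mulg1 -expgnDr subnKC // ltnW.
have gX k : (1 < k)%N -> generated [set x ^+ k] <> [set: G].
  move=> k1 kT; have : generated [set x ^+ k] x by rewrite kT.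
  move=> /cycleP[m [n]]; rewrite -!expgnA => e.
  have {e} : x ^+ (k * n).+1 = x ^+ (k * m).
    by rewrite expgS [X in X * _]e -mulgA mulVg mulg1.
  case: (ltngtP (k * n).+1 (k * m)) => [lt|lt|e _].
  - by move=> /expB/(_ lt).
  - by move=> /esym/expB/(_ lt).
  have : (k %| (k * n).+1)%N by rewrite e dvdn_mulr.
  rewrite -addn1 dvdn_addr ?dvdn_mulr // dvdn1 => /eqP k_1.
  by rewrite k_1 in k1.
have [|/gX-/(_ isT)//|/gX-/(_ isT)//] := irrG
  (subgroup_generated [set x ^+ 2]) (subgroup_generated [set x ^+ 3]).
move=> L sL /(_ _ (sub_generated _)) L2 /(_ _ (sub_generated _)) L3.
apply/seteqP; split=> // y _; have : generated [set x] y by rewrite xT.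
apply: generated_min => // _ ->.
have -> : x = x ^+ 3 / x ^+ 2 by rewrite expgS mulgK.
by have [_] := (subgroupP L).1 sL; apply; [apply: L3|apply: L2].
Qed.

(** The elements of [s] are discarded one at a time, since each of them
    generates a proper subgroup. *)
Lemma finitely_generated_over (s : seq G) H : subgroup H ->
  (forall L, subgroup L -> H `<=` L -> (forall r, r \in s -> L r) ->
    L = [set: G]) ->
  H = [set: G].
Proof.
elim: s H => [|r s IHs] H sH hs; first by apply: hs.
pose K := generated (H `|` [set r]).
have sK : subgroup K by apply: subgroup_generated.
have HK : H `<=` K by move=> x Hx; apply: sub_generated; left.
have Kr : K r by apply: sub_generated; right.
have KT : K = [set: G].
  apply: IHs => // L sL KL sLL; apply: hs => // [x /HK/KL//|t].
  by rewrite inE => /orP[/eqP->|/sLL//]; apply: KL.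
have [|//|/noncyclic//] := irrG sH (subgroup_generated [set r]).
move=> L sL HL rL; apply/seteqP; split=> // x _.
have : K x by rewrite KT.
apply: generated_min => // y [/HL//|->]; apply: rL; exact: sub_generated.
Qed.

Lemma no_finite_index H (s : seq G) : subgroup H ->
  (forall g, exists2 r, r \in s & H (g / r)) -> H = [set: G].
Proof.
move=> sH hs; apply: (@finitely_generated_over s) => // L sL HL sLL.
apply/seteqP; split=> // g _; have [r rs Hgr] := hs g.
by rewrite -(divgK r g); apply: subMg => //; [apply: HL | apply: sLL].
Qed.

Lemma derived_sub_normal H x g :
  subgroup H -> derived [set: G] `<=` H -> H x -> H (x ^ g).
Proof.
move=> sH DH Hx; have -> : x ^ g = x * [~ x, g] by rewrite commgEl mulVKg.
by apply: subMg => //; apply: DH; apply: commg_derived.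
Qed.

Lemma cycle_derived_proper x : [set: G] <> derived [set: G] ->
  generated ([set x] `|` derived [set: G]) <> [set: G].
Proof.
move=> nD gT; have sD : subgroup (derived [set: G]).
  exact: subgroup_generated.
have [|/noncyclic//|/esym//] := irrG (subgroup_generated [set x]) sD.
move=> L sL xL DL; apply/seteqP; split=> // y _.
have : generated ([set x] `|` derived [set: G]) y by rewrite gT.
by apply: generated_min => // z [->|/DL//]; apply: xL; apply: sub_generated.
Qed.

End GroupJoin.

(** * The action on minimax quotients *)

Section Action.
Variables (G : groupType) (A : zgModType G).
Implicit Types (P L M : set A) (a b : A) (g h : G) (H K : set G).

Lemma zgact0 g : zgact (0 : A) g = 0.
Proof. by apply: (@addrI _ (zgact 0 g)); rewrite -zgactD !addr0. Qed.

Lemma zgactN a g : zgact (- a) g = - zgact a g.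
Proof. by apply: (@addrI _ (zgact a g)); rewrite -zgactD !subrr zgact0. Qed.

Lemma zgactB a b g : zgact (a - b) g = zgact a g - zgact b g.
Proof. by rewrite zgactD zgactN. Qed.

Lemma zgactMn a n g : zgact (a *+ n) g = zgact a g *+ n.
Proof.
by elim: n => [|n IHn]; rewrite ?mulr0n ?zgact0 // !mulrS zgactD IHn.
Qed.

Lemma zgactK g a : zgact (zgact a g) g^-1%g = a.
Proof. by rewrite -zgactM mulgV zgact1. Qed.

Lemma zgactVK g a : zgact (zgact a g^-1%g) g = a.
Proof. by rewrite -zgactM mulVg zgact1. Qed.

Lemma centmE H a : a \in centm A H <-> forall h, H h -> zgact a h = a.
Proof. by split=> [/asboolP//|h]; apply/asboolP. Qed.

Definition stable P := forall a g, P a -> P (zgact a g).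

Lemma zsub_centm H : zsub [set a | a \in centm A H].
Proof. exact: zsub_of. Qed.

(** When [H] and [K] generate [G], the quotient A / C_A(G) is an extension of a
    submodule of A / C_A(K) by A / C_A(H). *)
Lemma join_irreducible_module : ~ minimax (quotmod (centm A [set: G])) ->
  (forall H, subgroup H -> H <> [set: G] -> minimax (quotmod (centm A H))) ->
  join_irreducible G.
Proof.
move=> nmG mH H K sH sK HK; apply: contrapT => /not_orP[nH nK]; apply: nmG.
have /minimax_quotmod mmH := mH H sH nH.
have /minimax_quotmod mmK := mH K sK nK.
apply/minimax_quotmod; apply: minimax_between_trans mmH.
have -> : [set a | a \in centm A [set: G]] =
    [set a | a \in centm A K] `&` [set a | a \in centm A H].
  apply/seteqP; split=> a /=.
    by move/centmE => aG; split; apply/centmE => h _; apply: aG.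
  move=> [/centmE aK /centmE aH]; apply/centmE.
  have sL : subgroup [set g | zgact a g = a].
    apply/subgroupP; split=> [|x y /= ax ay]; first exact: zgact1.
    by rewrite zgactM ax -[in LHS]ay zgactK.
  by move=> h _; have /seteqP[_ /(_ h)] := HK _ sL aH aK; apply.
rewrite -[X in minimax_between _ X]setTI.
by apply: minimax_betweenI mmK; apply: zsub_centm.
Qed.

Lemma stable_centm H : (forall x g, H x -> H (x ^ g)%g) ->
  stable [set a | a \in centm A H].
Proof.
move=> nH a g /= /centmE aH; apply/centmE => h Hh.
by rewrite -zgactM conjgCV zgactM aH //; apply: nH.
Qed.

Hypotheses (infG : infinite_set [set: G]) (irrG : join_irreducible G).

(** The stabiliser of a point of a finite set has finite index, so it is [G]. *)
Lemma trivial_on_finite L M :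
  zsub L -> stable L -> stable M -> finite_mod L M ->
  forall a g, M a -> L (zgact a g - a).
Proof.
move=> zL stL stM [s sP] a g Ma.
have sH : subgroup [set g | L (zgact a g - a)].
  apply/subgroupP; split=> [|x y /= Lx Ly].
    by rewrite /= zgact1 subrr; apply: zL.1.
  rewrite zgactM -[X in _ - X](zgactK y) -zgactB; apply: stL.
  by rewrite -(subrKA a) -[a - _]opprB; apply: zL.2.
(* For each representative w of a coset in the orbit of a, an element of G
   that moves a into that coset. *)
pose Q w (o : option G) := if o is Some r then L (zgact a r - w)
  else forall r, ~ L (zgact a r - w).
have [f fP] : {f : A -> option G & forall w, Q w (f w)}.
  apply: (@choice _ _ Q) => w.
  have [[r Lr]|h] := pselect (exists r, L (zgact a r - w)).
    by exists (Some r).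
  by exists None => r Lr; apply: h; exists r.
have /seteqP[_ /(_ g)] : [set g | L (zgact a g - a)] = [set: G]; last by apply.
apply: (@no_finite_index _ infG irrG _ (pmap f s)) => // h.
have [w ws Lw] := sP _ (stM a h Ma).
have := fP w; case E: (f w) => [r|]; last by move=> /(_ h).
move=> Lr; exists r; first by rewrite mem_pmap; apply/mapP; exists w.
rewrite /= zgactM -[X in _ - X](zgactK r) -zgactB; apply: stL.
by rewrite -(subrKA w) -[w - _]opprB; apply: zL.2.
Qed.

(** With W = A / P and m prime to the bad primes of W, [G] acts trivially on the
    finite groups W / m ^ k W, hence on W modulo torsion, and also on the
    torsion, which is the union of the finite groups W[n]. *)
Lemma unipotent_minimax P : zsub P -> stable P -> minimax_between P [set: A] ->
  forall a g h, let b := zgact a g - a in P (zgact b h - b).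
Proof.
move=> zP stP mP a g h b; have zT : zsub [set: A] by [].
have [_ fin] := bounded_finite_minimax zP mP.
(* N.+1 is an integer greater than 1 and prime to N. *)
have [N N0 /(_ N.+1)[//||_ red]] := coprime_reduced_minimax zP mP.
  exact: coprimeSn.
have [k|n n0 Pbn] := red b I.
  pose I := multiples (N.+1 ^ k) [set: A].
  have zI : zsub I by apply: zsub_multiples.
  have zL : zsub (zadd I P) by apply: zsub_zadd.
  have [_ [z [[y _ <-] Pz bE]]] : zadd I P b.
    apply: (@trivial_on_finite (zadd I P) [set: A]) => //.
      move=> _ x [_ [z [[y _ <-] Pz ->]]]; rewrite zgactD zgactMn.
      exists (zgact y x *+ (N.+1 ^ k)), (zgact z x).
      by split; [exists (zgact y x) | apply: stP |].
    apply: (fin _ _ (N.+1 ^ k)%N) => //.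
    + exact: zaddr.
    + by rewrite expn_gt0.
    + by move=> v _; apply: zaddl => //; exists v.
  by exists y => //; rewrite bE addrC addKr.
apply: (@trivial_on_finite P [set v | P (v *+ n)]) => //.
  by move=> v x /= Pv; rewrite -zgactMn; apply: stP.
apply: (fin _ _ n) => //.
  split=> [|x y /= Px Py]; first by rewrite /= mul0rn; apply: zP.1.
  by rewrite mulrnBl; apply: zP.2.
by move=> v Pv /=; apply: zsubMn.
Qed.

Hypotheses (nperfG : [set: G] <> derived [set: G])
    (minimaxH : forall H : set G, subgroup H -> H <> [set: G] ->
       minimax (quotmod (centm A H))).

(** [G] is the union of the proper normal subgroups <x> G', so the centraliser
    C_A(G) is the intersection of their centralisers. *)
Lemma unipotent a g h x : let b := zgact a g - a in
  zgact (zgact b h - b) x = zgact b h - b.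
Proof.
move=> b; pose H := generated ([set x] `|` derived [set: G]).
have sH : subgroup H by apply: subgroup_generated.
have DH : derived [set: G] `<=` H by move=> y Dy; apply: sub_generated; right.
have Hx : H x by apply: sub_generated; left.
have nH : H <> [set: G] by apply: cycle_derived_proper.
have /minimax_quotmod mH := minimaxH sH nH.
suff /centmE : [set c | c \in centm A H] (zgact b h - b) by apply.
apply: (unipotent_minimax (zsub_centm H) _ mH).
by apply: stable_centm => y k; apply: derived_sub_normal.
Qed.

End Action.

(** * Commutators *)

Section Central.
Variables (G : groupType) (A : zgModType G).
Implicit Types (a b : A) (g h k x y : G).
Hypothesis faithA : centg A = [set 1%g].
Hypothesis unip : forall a g h x, let b := zgact a g - a in
  zgact (zgact b h - b) x = zgact b h - b.

Lemma zgact_inj g h : (forall a : A, zgact a g = zgact a h) -> g = h.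
Proof.
move=> gh; apply: divg1_eq; suff: centg A (g / h)%g by rewrite faithA.
by move=> a; rewrite zgactM gh zgactK.
Qed.

(** Let d_g = g - 1.  A commutator c acts as 1 + w with w a combination of
    d_x d_y and d_y d_x up to an invertible factor; as all products of three
    d's vanish, w d_k = d_k w = 0 for every k. *)
Lemma commutator_central x y k : commute [~ x, y]%g k.
Proof.
have [d dE] : {d : A -> G -> A | forall a g, d a g = zgact a g - a} by eexists.
have dB a b g : d (a - b) g = d a g - d b g by rewrite !dE zgactB subrACA.
have ddd a g h t : d (d (d a g) h) t = 0.
  by rewrite !dE; have /= -> := unip a g h t; rewrite subrr.
set c := [~ x, y]%g.
have dc b : d b c =
    let a := zgact b (y * x)^-1%g in d (d a x) y - d (d a y) x.
  have := zgactVK (y * x)%g b; move: (zgact b _) => a /= bE.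
  have bc : zgact b c = zgact a (x * y)%g by rewrite commgC zgactM bE.
  rewrite dE bc -bE !dE !zgactB -!zgactM subrACA [X in _ = X - _]subrACA.
  by rewrite [X in _ = _ - X]subrACA subrr subr0 opprB addrK.
clearbody c.
have cA b t : zgact (zgact b c) t = zgact b t + (zgact b c - b).
  have : d (d b c) t = 0 by rewrite dc /= dB !ddd subr0.
  by rewrite dE => /subr0_eq; rewrite {1}dE zgactB -dE => <-; rewrite subrKC.
apply: zgact_inj => a; rewrite !zgactM cA.
have : d (d a k) c = 0.
  rewrite dc /= (dE a k) zgactB -!zgactM.
  have D g h : zgact a g - zgact a h = d a g - d a h.
    by rewrite !dE subrACA subrr subr0.
  by rewrite D !dB !ddd !subr0.
by rewrite !dE zgactB => /subr0_eq/(canRL (subrK _))->; rewrite addrCA addrC.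
Qed.

End Central.

Section CentralExtension.
Variables (G : groupType) (D : set G).
Implicit Types x y z : G.
Local Open Scope group_scope.

(** Modulo [D] let n x = 0 and y = n z; then (x, y) = n (x, z) = (n x, z) is
    trivial, as commutation is bilinear when commutators are central. *)
Lemma commute_divisible_torsion :
  (forall x y, D [~ x, y]) -> (forall d x, D d -> commute d x) ->
  (forall x, exists2 n, (0 < n)%N & D (x ^+ n)) ->
  (forall y n, (0 < n)%N -> exists z, D (y / z ^+ n)) ->
  forall x y, commute x y.
Proof.
move=> commD centD tors divi x y.
have [n n0 Dxn] := tors x; have [z Dz] := divi y n n0.
have xzn : commute x (z ^+ n).
  have cC t : commute [~ x, z] t by apply: centD.
  have cn1 : [~ x, z] ^+ n = 1.
    have: (x ^+ n) ^ z = x ^+ n by apply/conjg_fixP/commgP/centD.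
    have xz : x ^ z = x * [~ x, z] by rewrite commgEl mulVKg.
    rewrite conjXg xz expgMn; last by apply/commute_sym/cC.
    by rewrite -[RHS]mulg1 => /mulgI.
  apply/commgP; rewrite -conjg_fix; apply/eqP.
  rewrite -[RHS]mulg1 -cn1; elim: n {n0 Dxn Dz cn1} => [|n IHn].
    by rewrite !expg0 conjg1 mulg1.
  rewrite expgSr conjgM IHn conjMg conjXg.
  have -> : [~ x, z] ^ z = [~ x, z] by apply/conjg_fixP/commgP/cC.
  by rewrite expgS mulgA commgEl mulVKg.
rewrite -(divgK (z ^+ n) y); apply: commuteM => //; exact/commute_sym/centD.
Qed.

End CentralExtension.

(** * The abelianization *)

Section Abelianization.
Variable G : groupType.
Local Open Scope group_scope.

Definition same_coset (x y : G) : bool := `[< derived [set: G] (x / y) >].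

Let D := derived [set: G].
Let sD : subgroup D. Proof. exact: subgroup_generated. Qed.
Let DJ x g : D x -> D (x ^ g). Proof. exact: derived_sub_normal. Qed.

Lemma same_coset_equiv : equiv_class_of same_coset.
Proof.
split=> [x|x y|y x z].
- by apply/asboolP; rewrite mulgV; apply: sub1g.
- by apply/asboolP/asboolP => /(subVg sD); rewrite invgM invgK.
- move=> /asboolP xy /asboolP yz; apply/asboolP.
  by rewrite -(divgKA y); apply: (subMg sD).
Qed.

Canonical same_coset_equiv_rel := EquivRelPack same_coset_equiv.

Definition abelianization := {eq_quot same_coset}%qT.
HB.instance Definition _ := Choice.on abelianization.

Definition abel (x : G) : abelianization := \pi_(abelianization)%qT x.

Lemma abelP x y : abel x = abel y <-> D (x / y).
Proof. by split=> [/eqmodP/asboolP|h]; last exact/eqmodP/asboolP. Qed.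

Definition abel_add (u v : abelianization) := abel (repr u * repr v)%qT.
Definition abel_opp (u : abelianization) := abel (repr u)^-1%qT.

Lemma abel_surj u : exists x, abel x = u.
Proof. by exists (repr u); apply: reprK. Qed.

Lemma abelM x y : abel (x * y) = abel_add (abel x) (abel y).
Proof.
have /abelP Dx : abel x = abel (repr (abel x)) by rewrite /abel reprK.
have /abelP Dy : abel y = abel (repr (abel y)) by rewrite /abel reprK.
apply/abelP; set r := repr (abel x) in Dx *; set t := repr (abel y) in Dy *.
have -> : x * y / (r * t) = (y / t) ^ x^-1 * (x / r).
  by rewrite conjgE invgK invgM -!mulgA mulKg.
by apply: (subMg sD) => //; apply: DJ.
Qed.

Lemma abel_addA : associative abel_add.
Proof.
move=> u v w; have [x <-] := abel_surj u; have [y <-] := abel_surj v.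
by have [z <-] := abel_surj w; rewrite -!abelM mulgA.
Qed.

Lemma abel_addC : commutative abel_add.
Proof.
move=> u v; have [x <-] := abel_surj u; have [y <-] := abel_surj v.
rewrite -!abelM; apply/abelP; rewrite (commgCV x y) mulgK.
exact: commg_derived.
Qed.

Lemma abel_add0 : left_id (abel 1) abel_add.
Proof. by move=> u; have [x <-] := abel_surj u; rewrite -abelM mul1g. Qed.

Lemma abel_addN : left_inverse (abel 1) abel_opp abel_add.
Proof.
move=> u; have e : abel (repr u) = u by apply: reprK.
by rewrite /abel_opp -[in X in abel_add _ X]e -abelM mulVg.
Qed.

HB.instance Definition _ := GRing.isZmodule.Build abelianization
  abel_addA abel_addC abel_add0 abel_addN.

Lemma abelD x y : abel (x * y) = (abel x + abel y)%R.
Proof. exact: abelM. Qed.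

Lemma abel0 : abel 1 = 0%R.
Proof. by []. Qed.

Lemma abel_eq0 x : abel x = 0%R <-> D x.
Proof. by rewrite -abel0 -[x in D x]divg1; apply: abelP. Qed.

Lemma abelV x : abel x^-1 = (- abel x)%R.
Proof. by apply: (@addrI _ (abel x)); rewrite -abelD mulgV subrr. Qed.

Lemma abelX x n : abel (x ^+ n) = (abel x *+ n)%R.
Proof. by elim: n => [|n IHn]; rewrite ?expg0 // expgS abelD IHn mulrS. Qed.

Definition zjoin_irreducible (B : zmodType) :=
  forall U W : set B, zsub U -> zsub W ->
  zadd U W = [set: B] -> U = [set: B] \/ W = [set: B].

Lemma subgroup_abel_pre (U : set abelianization) :
  zsub U -> subgroup [set x | U (abel x)].
Proof.
move=> zU; apply/subgroupP; split=> [|x y /= Ux Uy].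
  by rewrite /= abel0; apply: zU.1.
by rewrite abelD abelV; apply: zU.2.
Qed.

Lemma join_irreducible_abel :
  join_irreducible G -> zjoin_irreducible abelianization.
Proof.
move=> uG U W zU zW UW.
have [||] := uG _ _ (subgroup_abel_pre zU) (subgroup_abel_pre zW).
- move=> L sL UL WL; apply/seteqP; split=> // x _.
  have [u [w [Uu Ww xE]]] : zadd U W (abel x) by rewrite UW.
  have [z zE] := abel_surj w; rewrite -(divgK z x); apply: (subMg sL).
    by apply: UL; rewrite /= abelD abelV zE xE addrK.
  by apply: WL; rewrite /= zE.
- move=> UT; left; apply/seteqP; split=> // u _; have [x <-] := abel_surj u.
  by have /seteqP[_ /(_ x)] := UT; apply.
- move=> UT; right; apply/seteqP; split=> // u _; have [x <-] := abel_surj u.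
  by have /seteqP[_ /(_ x)] := UT; apply.
Qed.

Lemma noncyclic_abel :
  infinite_set [set: G] -> join_irreducible G -> [set: G] <> D ->
  forall u : abelianization, zcyc u <> [set: abelianization].
Proof.
move=> infG uG nD u; have [x <-] := abel_surj u => xT.
apply: (cycle_derived_proper infG uG nD (x := x)).
set H := generated _; have sH : subgroup H by apply: subgroup_generated.
have Hx : H x by apply: sub_generated; left.
apply/seteqP; split=> // y _.
have [k yE] : zcyc (abel x) (abel y) by rewrite xT.
have [z Hz zE] : exists2 z, H z & abel z = abel y.
  rewrite yE; case: k {yE} => n.
    by exists (x ^+ n); [exact: (subXg _ sH Hx) | rewrite abelX].
  exists (x ^- n.+1); first exact: (subVg sH (subXg _ sH Hx)).
  by rewrite abelV abelX NegzE mulrNz.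
rewrite -(divgK z y); apply: (subMg sH) => //; apply: sub_generated; right.
by apply/abelP.
Qed.

End Abelianization.

(** * Join-irreducible abelian groups *)

Section JoinIrreducible.
Variable B : zmodType.
Implicit Types (E M U W : set B) (g x y : B).

(** By maximality the quotient B / M is cocyclic: the class of [y] belongs to
    each of its nonzero subgroups. *)
Lemma maximal_avoiding E y : zsub E -> ~ E y ->
  exists M, [/\ zsub M, E `<=` M, ~ M y &
    forall g, ~ M g -> exists k : int, M (y - g *~ k)].
Proof.
move=> zE nEy.
(* Zorn's lemma is applied to the sets S such that E `|` S is an admissible
   subgroup, so that the empty chain has an upper bound. *)
pose Z := [set S : set B | zsub (E `|` S) /\ ~ (E `|` S) y].
have [F FZ Ftot|S [[zS nSy] Smax]] := @Zorn_bigcup _ Z.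
  split; last by move=> [//|[X /FZ[_ nX] Xy]]; apply: nX; right.
  split=> [|u v]; first by left; apply: zE.1.
  have inX X : F X -> (E `|` X) u -> (E `|` X) v ->
      (E `|` \bigcup_(X in F) X) (u - v).
    move=> FX Xu Xv; have [[_ zXB] _] := FZ _ FX.
    by have [] := zXB u v Xu Xv; [left | right; exists X].
  move=> [Eu|[X FX Xu]] [Ev|[Y FY Yv]].
  - by left; apply: zE.2.
  - by apply: (inX Y); [| left | right].
  - by apply: (inX X); [| right | left].
  - have [XY|YX] := Ftot X Y FX FY.
      by apply: (inX Y); [| right; apply: XY | right].
    by apply: (inX X); [| right | right; apply: YX].
exists (E `|` S); split=> // g nSg.
pose T := zadd (E `|` S) (zcyc g).
have zT : zsub T by apply: zsub_zadd => //; apply: zsub_zcyc.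
have ST : E `|` S `<=` T by apply: zaddl; apply: zsub_zcyc.
have ET : E `|` T = T by apply/setUidPr => x Ex; apply: ST; left.
have Tg : T g by apply: zaddr => //; apply: zcyc_id.
have : ~ Z T.
  apply: Smax; split; first by move=> x Sx; apply: ST; right.
  by move=> TS; apply: nSg; right; apply: TS.
move=> nT; have [m [_ [Mm [k ->] yE]]] : T y.
  by apply: contrapT => nTy; apply: nT; split; rewrite ET.
by exists k; rewrite yE addrK.
Qed.

Hypotheses (irrB : zjoin_irreducible B) (ncycB : forall x, zcyc x <> [set: B]).

(** If [y] is not in p B, let [M] contain p B and be maximal avoiding [y]; then
    B / M has order p, so that [B] is the join of [M] and the cyclic group of
    [y]. *)
Lemma divisible_prime p y : prime p -> exists z, z *+ p = y.
Proof.
move=> pp; apply: contrapT => ny; pose E := multiples p [set: B].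
have zE : zsub E by apply: zsub_multiples.
have nEy : ~ E y by move=> [z _ zy]; apply: ny; exists z.
have [M [zM EM nMy Mmax]] := maximal_avoiding zE nEy.
have [||] := irrB (zsub_zcyc y) zM; last 2 first.
- exact: ncycB.
- by move=> MT; apply: nMy; rewrite MT.
apply/seteqP; split=> // g _.
have zy := zsub_zcyc y.
have [Mg|nMg] := pselect (M g); first exact: zaddr.
have [k Mk] := Mmax g nMg.
have npk : ~~ (p %| k)%Z.
  apply/negP => /dvdzP[l kE]; apply: nMy.
  rewrite -(subrK (g *~ k) y); apply: zsubD => //.
  by apply: EM; exists (g *~ l); rewrite // kE mulrzA -pmulrn.
apply: (zsub_prime (k := k) (zsub_zadd zy zM) pp _ _ npk).
  exists y, (g *~ k - y); rewrite subrKC; split=> //; first exact: zcyc_id.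
  by rewrite -opprB; apply: zsubN.
by apply: zaddr => //; apply: EM; exists g.
Qed.

Lemma divisible n y : (0 < n)%N -> exists z, z *+ n = y.
Proof.
elim/ltn_ind: n y => n IHn y n0.
have [n1|n1] := leqP n 1.
  by exists y; have -> : n = 1%N by apply/eqP; rewrite eqn_leq n1.
have pp := pdiv_prime n1.
have np : n = (n %/ pdiv n * pdiv n)%N by rewrite divnK ?pdiv_dvd.
have [z <-] := divisible_prime y pp.
have [||w <-] := IHn (n %/ pdiv n)%N _ z.
- by rewrite ltn_Pdiv // prime_gt1.
- by rewrite divn_gt0 ?prime_gt0 // dvdn_leq // pdiv_dvd.
by exists w; rewrite -mulrnA -np.
Qed.

(** Every nonzero subgroup of B / M contains the class of [y], which has order
    p, when [M] is maximal among the subgroups that contain p y but not y. *)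
Lemma maximal_avoiding_primary y p : prime p -> ~ zcyc (y *+ p) y ->
  exists M, [/\ zsub M, ~ M y & forall g, exists a, M (g *+ p ^ a)].
Proof.
move=> pp ny.
have [M [zM EM nMy Mmax]] := maximal_avoiding (zsub_zcyc (y *+ p)) ny.
have Myp : M (y *+ p) by apply/EM/zcyc_id.
exists M; split=> // g.
have [Mg|nMg] := pselect (M g); first by exists 0%N; rewrite expn0 mulr1n.
have [k Mk] := Mmax g nMg.
have k0 : k != 0 by apply/eqP => k0; rewrite k0 mulr0z subr0 in Mk.
have Mgkp : M (g *+ (`|k| * p)).
  have Mgk : M (g *~ k *+ p).
    by rewrite -[_ *~ _](subKr y) mulrnBl; apply: zM.2 => //; apply: zsubMn.
  rewrite mulnC mulrnA; apply: zsub_absz => //.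
  by rewrite pmulrn mulrzAC -pmulrn.
have n0 : (0 < `|k| * p)%N by rewrite muln_gt0 absz_gt0 k0 prime_gt0.
have [m pm nE] := pfactor_coprime pp n0.
set a := logn _ _ in nE; exists a; apply: contrapT => nMh.
have [l Ml] := Mmax _ nMh; apply: nMy; rewrite coprime_sym in pm.
apply: (zsub_coprime zM pm) => //.
rewrite -(subrK (g *+ p ^ a *~ l) y) mulrnDl.
apply: zsubD => //; first exact: zsubMn.
rewrite pmulrn mulrzAC -pmulrn -mulrnA mulnC -nE.
by rewrite pmulrn mulrzAC -pmulrn; apply: zsubMz.
Qed.

(** For [y] of infinite order, [B] would be the join of two proper subgroups
    whose quotients are a 2-group and a 3-group. *)
Lemma torsion y : exists2 n, (0 < n)%N & y *+ n = 0.
Proof.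
apply: contrapT => ntor.
have ny p : prime p -> ~ zcyc (y *+ p) y.
  move=> pp [k yE]; apply: ntor; pose d := 1 - p%:Z * k.
  have d0 : d != 0.
    rewrite subr_eq0; apply/negP => /eqP e.
    have : (p %| 1)%Z by apply/dvdzP; exists k; rewrite mulrC.
    by rewrite dvdz1 /= => /eqP p1; rewrite p1 in pp.
  exists `|d|%N; first by rewrite absz_gt0.
  apply: (zsub_absz (@zsub_zero B)).
  by rewrite /d /= mulrzBr mulr1z mulrzA -pmulrn -yE subrr.
have [M [zM nMy Mtor]] :=
  maximal_avoiding_primary (isT : prime 2) (ny 2%N isT).
have [N [zN nNy Ntor]] :=
  maximal_avoiding_primary (isT : prime 3) (ny 3%N isT).
have [||] := irrB zM zN; last 2 first.
- by move=> MT; apply: nMy; rewrite MT.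
- by move=> NT; apply: nNy; rewrite NT.
apply/seteqP; split=> // g _; have [a Ma] := Mtor g; have [b Nb] := Ntor g.
apply: (zsub_coprime (m := (2 ^ a)%N) (n := (3 ^ b)%N) (zsub_zadd zM zN)).
- by rewrite coprimeXl // coprimeXr.
- exact: zaddl.
- exact: zaddr.
Qed.

(** [B] is the join of its q-primary part and of the elements of order prime to
    q. *)
Lemma primary_group : (exists x : B, x != 0) -> exists q (x : B),
  [/\ prime q, x != 0, x *+ q = 0 & forall v : B, exists a, v *+ q ^ a = 0].
Proof.
move=> [x0 x0N]; have [n0 n0_gt0 xn0] := torsion x0.
have ex : exists n, (0 < n)%N && (x0 *+ n == 0).
  by exists n0; rewrite n0_gt0 xn0 eqxx.
case: (ex_minnP ex) => n /andP[n_gt0 /eqP xn] nmin.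
have n1 : (1 < n)%N.
  rewrite ltnNge; apply: contra x0N => n1.
  have n_1 : n = 1%N by apply/eqP; rewrite eqn_leq n1.
  by rewrite -[x0]mulr1n -n_1 xn.
have qp := pdiv_prime n1; set q := pdiv n in qp.
have nq : n = (n %/ q * q)%N by rewrite divnK ?pdiv_dvd.
have nq_gt0 : (0 < n %/ q)%N.
  by rewrite divn_gt0 ?prime_gt0 // dvdn_leq // pdiv_dvd.
pose x := x0 *+ (n %/ q).
have xN : x != 0.
  apply/negP => x_0; have := nmin (n %/ q)%N; rewrite nq_gt0 x_0 => /(_ isT).
  by rewrite leqNgt ltn_Pdiv // prime_gt1.
have xq : x *+ q = 0 by rewrite -mulrnA -nq.
exists q, x; split=> //.
have z0 := @zsub_zero B.
pose U := [set v : B | exists a, v *+ q ^ a = 0].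
pose W := [set v : B | exists2 m, coprime m q & v *+ m = 0].
have zU : zsub U.
  split=> [|u v [a ua] [b vb]]; first by exists 0%N; rewrite mul0rn.
  exists (a + b)%N.
  by rewrite mulrnBl expnD mulrnA ua mul0rn mulnC mulrnA vb mul0rn subrr.
have zW : zsub W.
  split=> [|u v [a ca ua] [b cb vb]].
    by exists 1%N; rewrite ?coprime1n // mul0rn.
  exists (a * b)%N; first by rewrite coprimeMl ca.
  by rewrite mulrnBl mulrnA ua mul0rn mulnC mulrnA vb mul0rn subrr.
have [||] := irrB zU zW; last 2 first.
- by move=> UT v; have : U v by rewrite UT.
- move=> WT; have [m cm xm] : W x by rewrite WT.
  by move/eqP: xN; case; apply: (zsub_coprime z0 cm).
apply/seteqP; split=> // v _; have [k k0 vk] := torsion v.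
have [m qm kE] := pfactor_coprime qp k0.
apply: (zsub_coprime (m := m) (n := (q ^ logn q k)%N) (zsub_zadd zU zW)).
- by rewrite coprimeXr // coprime_sym.
- by apply: zaddl => //; exists (logn q k); rewrite -mulrnA -kE.
- by apply: zaddr => //; exists m; rewrite 1?coprime_sym // -mulrnA mulnC -kE.
Qed.

(** The [e n] generate a divisible subgroup [H] all of whose nonzero subgroups
    contain e 0.  If [M] is maximal avoiding e 0, then [B] is the join of [H]
    and [M], hence equal to [H]. *)
Lemma prufer_basis : (exists x : B, x != 0) -> exists q (e : nat -> B),
  [/\ prime q, e 0%N != 0, e 0%N *+ q = 0, forall n, e n.+1 *+ q = e n &
      forall v : B, exists n k, v = e n *~ k].
Proof.
move=> /primary_group[q [x [qp x0 xq prim]]].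
have [rt rtP] : {rt : B -> B & forall v, rt v *+ q = v}.
  by apply: (@choice _ _ (fun v w => w *+ q = v)) => v; apply: divisible_prime.
pose e n := iter n rt x; exists q, e; split=> //; first by move=> n; apply: rtP.
have eX n j : e (j + n)%N *+ q ^ j = e n.
  elim: j => [|j IHj]; first by rewrite expn0 mulr1n.
  by rewrite expnS mulrnA addSn rtP.
pose H := [set v | exists n k, v = e n *~ k].
have zH : zsub H.
  split=> [|_ _ [n [k ->]] [m [l ->]]].
    by exists 0%N, 0; rewrite mulr0z.
  exists (m + n)%N, ((q ^ m)%N%:Z * k - (q ^ n)%N%:Z * l).
  by rewrite mulrzBr !mulrzA -!pmulrn eX addnC eX.
have Hx : H x by exists 0%N, 1; rewrite mulr1z.
have z0 := @zsub_zero B.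
have [M [zM _ nMx Mmax]] := maximal_avoiding z0 (elimN eqP x0).
have zHM := zsub_zadd zH zM.
have HM a g : M (g *+ q ^ a) -> zadd H M g.
  elim: a g => [|a IHa] g; first by rewrite expn0 mulr1n; apply: zaddr.
  rewrite expnS mulrnA => /IHa[_ [m [[n [k ->]] Mm gqE]]].
  (* h has the same multiple by q as g modulo M. *)
  pose h := e n.+1 *~ k; have hq : h *+ q = e n *~ k.
    by rewrite /h pmulrn mulrzAC -pmulrn rtP.
  have Hh : H h by exists n.+1, k.
  rewrite -(subrK h g); apply: zsubD => //; last exact: zaddl.
  have Mq : M ((g - h) *+ q) by rewrite mulrnBl hq gqE addrC addKr.
  have [Mu|/Mmax[l Ml]] := pselect (M (g - h)); first exact: zaddr.
  have nql : ~~ (q %| l)%Z.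
    apply/negP => /dvdzP[l' lE]; apply: nMx.
    rewrite -(subrK ((g - h) *~ l) x); apply: zsubD => //.
    by rewrite lE mulrC mulrzA -pmulrn; apply: zsubMz.
  apply: (zsub_prime (k := l) zHM qp _ _ nql); last exact: zaddr.
  exists x, ((g - h) *~ l - x); rewrite subrKC; split=> //.
  by have := zsubN zM Ml; rewrite opprB.
have [||] := irrB zH zM.
- apply/seteqP; split=> // g _; have [a ga] := prim g.
  by apply: (HM a); rewrite ga; apply: zM.1.
- by move=> HT v; have : H v by rewrite HT.
- by move=> MT; case: nMx; rewrite MT.
Qed.

End JoinIrreducible.

(** * Identification with the Pruefer group *)

Section Prufer.
Variables (B : zmodType) (q : nat) (e : nat -> B).
Hypotheses (qp : prime q) (e0 : e 0%N != 0) (e0q : e 0%N *+ q = 0)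
  (eS : forall n, e n.+1 *+ q = e n)
  (eT : forall v : B, exists n k, v = e n *~ k).

Let qX n : (q ^ n)%:R != 0 :> rat.
Proof. by rewrite pnatr_eq0 -lt0n expn_gt0 prime_gt0. Qed.

Let eX n j : e (j + n)%N *+ q ^ j = e n.
Proof.
elim: j => [|j IHj]; first by rewrite expn0 mulr1n.
by rewrite expnS mulrnA addSn eS.
Qed.

Let z0 := @zsub_zero B.

Let e_ord n (k : int) : e n *~ k = 0 <-> ((q ^ n.+1)%N %| k)%Z.
Proof.
split; last first.
  move=> /dvdzP[l ->]; rewrite mulrC mulrzA -pmulrn expnSr mulrnA.
  by rewrite -{1}[n]addn0 eX e0q mul0rz.
elim: n k => [|n IHn] k ek.
  rewrite expn1; apply: contrapT => /negP qk; move/eqP: e0; case.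
  exact: (zsub_prime z0 qp ek e0q qk).
have /IHn/dvdzP[l kE] : e n *~ k = 0 by rewrite -eS pmulrn mulrzAC ek mul0rz.
have el : e 0%N *~ l = 0.
  by rewrite -(eX 0%N n.+1) addn0 pmulrn -mulrzA mulrC -kE.
have /dvdzP[l' lE] : (q %| l)%Z.
  apply: contrapT => /negP ql; move/eqP: e0; case.
  exact: (zsub_prime z0 qp el e0q ql).
by apply/dvdzP; exists l'; rewrite kE lE -mulrA -PoszM -expnS.
Qed.

(* The rationals r that represent v, when e n is sent to q ^- n.+1: they are
   determined up to an integer, as shown by slopeB and slope_int. *)
Let slope (v : B) (r : rat) := exists n (k : int),
  v = e n *~ k /\ r = k%:~R / (q ^ n.+1)%:R.

Let scale m n (k : int) :
  (q ^ m)%:R * k%:~R / (q ^ (m + n.+1))%:R = k%:~R / (q ^ n.+1)%:R :> rat.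
Proof. by rewrite expnD natrM invfM mulrACA divff ?mul1r. Qed.

Let slopeB v w r s : slope v r -> slope w s -> slope (v - w) (r - s).
Proof.
move=> [n [k [-> ->]]] [m [l [-> ->]]].
exists (m + n)%N, ((q ^ m)%N%:Z * k - (q ^ n)%N%:Z * l); split.
  by rewrite mulrzBr !mulrzA -!pmulrn eX addnC eX.
rewrite rmorphB !rmorphM /= mulrBl; congr (_ - _).
  by rewrite -addnS; apply/esym/scale.
by rewrite addnC -addnS; apply/esym/scale.
Qed.

Let slope_int v r : slope v r -> v = 0 <-> r \is a Num.int.
Proof.
move=> [n [k [-> ->]]]; rewrite e_ord; split=> [/dvdzP[l ->]|/intrP[l]].
  by rewrite rmorphM /= mulfK ?rpred_int //; apply: qX.
move/(canRL (divfK (qX _))); rewrite -[(_)%:R]/((q ^ n.+1)%N%:Z%:~R).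
rewrite -rmorphM /= => /intr_inj->.
exact: dvdz_mull.
Qed.

Let slope_val r n : r * (q ^ n)%:R \is a Num.int -> exists v, slope v r.
Proof.
move=> /intrP[k rE]; exists (e n *~ (k * q)), n, (k * q); split=> //.
have := mulfK (qX n.+1) r; rewrite {1}expnSr natrM mulrA rE => {1}<-.
by rewrite rmorphM.
Qed.

(** k e_n is sent to the class of k / q ^ n.+1. *)
Lemma prufer_iso : exists f : B -> quasi_cyclic q, bijective f /\
  forall x y, f (x + y) = f x + f y.
Proof.
have [r rP] : {r : B -> rat & forall v, slope v (r v)}.
  apply: (@choice _ _ slope) => v; have [n [k vE]] := eT v.
  by exists (k%:~R / (q ^ n.+1)%:R), n, k.
pose c (v : B) : rat_mod_int := qpi int_pred (r v).
have c_eq v s : slope v s -> c v = qpi int_pred s.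
  move=> vs; apply/subr0_eq; rewrite /c -qpiB; apply/qpi_eq0.
  by apply/(slope_int (slopeB (rP v) vs)); rewrite subrr.
have cD u v : c (u + v) = c u + c v.
  have s0 : slope 0 0 by exists 0%N, 0; rewrite mulr0z mul0r.
  have := slopeB (rP u) (slopeB s0 (rP v)); rewrite !sub0r !opprK => /c_eq->.
  exact: qpiD.
have c0 v : c v = 0 -> v = 0 by move/qpi_eq0/(slope_int (rP v)).
have cMn v n : c (v *+ n) = c v *+ n.
  elim: n => [|n IHn]; last by rewrite !mulrS cD IHn.
  by apply: (@addrI _ (c 0)); rewrite -cD !mulr0n !addr0.
have c_prim v : c v \in primary rat_mod_int q.
  have [n [k vE]] := eT v; apply/asboolP; exists n.+1.
  rewrite -cMn; have -> : v *+ q ^ n.+1 = 0.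
    rewrite vE pmulrn mulrzAC -pmulrn -{1}[n]addn0 expnSr mulrnA.
    by rewrite eX e0q mul0rz.
  by have := cMn 0 0%N; rewrite !mulr0n.
pose f v : quasi_cyclic q := Sub (c v) (c_prim v).
have fE v : val (f v) = c v by rewrite SubK.
have fD u v : f (u + v) = f u + f v.
  by apply: val_inj; rewrite [RHS]raddfD; apply: cD.
have f_inj u v : f u = f v -> u = v.
  move=> /(congr1 val); rewrite !fE => cuv; apply/subr0_eq/c0.
  by apply: (@addIr _ (c v)); rewrite -cD subrK add0r.
have f_surj w : exists v, f v = w.
  have /asboolP[n] := valP w; have [s sE] := qpi_surj (val w).
  rewrite -sE => sn.
  have /slope_val[v vs] : s * (q ^ n)%:R \is a Num.int.
    by rewrite mulr_natr; apply/(qpi_eq0 int_pred); rewrite qpiMn.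
  by exists v; apply: val_inj; rewrite fE -sE; apply: c_eq.
exists f; split=> //; have [g gK] := choice f_surj.
by exists g => // v; apply: f_inj; rewrite gK.
Qed.

End Prufer.

Local Close Scope ring_scope.

Theorem theorem2p2 (G : groupType) (A : zgModType G)
    (infG : infinite_set [set: G])
    (lsG : locally_soluble G)
    (nperfG : [set: G] <> derived [set: G])
    (faithA : centg A = [set 1%g])
    (nminimaxG : ~ minimax (quotmod (centm A [set: G])))
    (minimaxH : forall H : set G, subgroup H -> H <> [set: G] ->
       minimax (quotmod (centm A H))) :
  exists q : nat, prime q /\ isomorphic_to G (quasi_cyclic q).
Proof.
have irrG := join_irreducible_module nminimaxG minimaxH.
have irrB := join_irreducible_abel irrG.
have ncycB := noncyclic_abel infG irrG nperfG.
have central := commutator_central faithA (unipotent infG irrG nperfG minimaxH).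
pose D := derived [set: G].
have D_comm x y : D [~ x, y]%g by apply: commg_derived.
have D_central d x : D d -> commute d x.
  suff : D `<=` [set d | commute d x] by apply.
  apply: generated_min => [|_ [y _ [z _ <-]]]; last exact: central.
  apply/subgroupP; split=> [|y z /= yx zx]; first exact/commute_sym/commute1.
  exact/commute_sym/commuteM/commuteV/commute_sym/zx/commute_sym.
have abG : forall x y : G, commute x y.
  apply: (commute_divisible_torsion D_comm D_central) => [x|y n n0].
    have [n n0 xn] := torsion irrB (abel x).
    by exists n => //; apply/abel_eq0; rewrite abelX.
  have [u yE] := divisible irrB ncycB (abel y) n0.
  have [z zE] := abel_surj u.
  by exists z; apply/abelP; rewrite abelX zE yE.
have D1 x : D x -> x = 1%g.
  suff : D `<=` [set 1%g] by apply.
  apply: generated_min => [|_ [y _ [z _ <-]]]; last by apply/eqP/commgP.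
  by apply/subgroupP; split=> // y z /= -> ->; rewrite /= mulgV.
have abel_inj : injective (@abel G) by move=> x y /abelP/D1/divg1_eq.
have nzB : exists u : abelianization G, u != 0%R.
  apply: contrapT => B0; apply: nperfG; apply/seteqP; split=> // x _.
  by apply/abel_eq0; apply: contrapT => /eqP x0; apply: B0; exists (abel x).
have [q [e [qp e0 e0q eS eT]]] := prufer_basis irrB ncycB nzB.
have [f [f_bij fD]] := prufer_iso qp e0 e0q eS eT.
have [g gK] := choice (@abel_surj G).
exists q; split=> //; exists (f \o @abel G); split; last first.
  by move=> x y /=; rewrite abelD.
by apply: bij_comp f_bij _; exists g => // x; apply: abel_inj; rewrite gK.
Qed.
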